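(* Let $n$, $k_1$, $k_2$ and $t$ be positive integers with $k_1\geq k_2\geq t+1$ and $n\geq (t+1)^2(k_1+k_2)^2(k_1-t+1)(k_2-t+1)+k_1+k_2-t$. Suppose that $\mathcal{F}_1\subseteq \binom{[n]}{k_1}$ and $\mathcal{F}_2\subseteq \binom{[n]}{k_2}$ are cross $t$-intersecting families with $\tau_t(\mathcal{F}_1)\geq t+1$ and $\tau_t(\mathcal{F}_2)\geq t+1$, such that $|\mathcal{F}_1||\mathcal{F}_2|$ is maximized (among all such pairs, for the given $n,k_1,k_2,t$). (i) If $t\geq 2$, then $(\mathcal{F}_1,\mathcal{F}_2)$ is isomorphic to $(\mathcal{A}(k_1,t),\mathcal{A}(k_2,t))$, or to $(\mathcal{C}_1(k_1,t),\mathcal{C}_2(k_2,t;k_1))$, or to $(\mathcal{H}(k_1,t;X,Y),\mathcal{H}(k_2,t;Y,X))$ for some $X\in \binom{[t+1,n]}{k_1-t+1}$ and $Y\in \binom{[t+1,n]}{k_2-t+1}$ with $|X\cap Y|\geq 2$. (ii) If $t=1$, then $(\mathcal{F}_1,\mathcal{F}_2)$ is isomorphic to $(\mathcal{A}(k_1,1),\mathcal{A}(k_2,1))$, or to $(\mathcal{B}(k_1;(1,3,2,4)),\mathcal{B}(k_2;(1,2,3,4)))$, or to $(\mathcal{H}(k_1,1;X,Y),\mathcal{H}(k_2,1;Y,X))$ for some $X\in \binom{[2,n]}{k_1}$ and $Y\in \binom{[2,n]}{k_2}$ with $|X\cap Y|\geq 1$.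
   Context: Notation: $[a,b]=\{a,a+1,\dots,b\}$, $[n]=[1,n]$; $\binom{M}{k}$ is the family of all $k$-subsets of $M$; for $S\subseteq[n]$, $[S\rangle_k=\{F\in\binom{[n]}{k}: S\subseteq F\}$. For $\mathcal{F}\subseteq\binom{[n]}{k}$, a set $T\subseteq[n]$ is a $t$-cover of $\mathcal{F}$ if $|T\cap F|\geq t$ for all $F\in\mathcal{F}$; the $t$-covering number $\tau_t(\mathcal{F})$ is the minimum size of a $t$-cover of $\mathcal{F}$. Families $\mathcal{F}\subseteq\binom{[n]}{k}$ and $\mathcal{G}\subseteq\binom{[n]}{\ell}$ are cross $t$-intersecting if $|F\cap G|\geq t$ for all $F\in\mathcal{F}$, $G\in\mathcal{G}$. Two pairs $(\mathcal{F},\mathcal{G})$ and $(\mathcal{F}',\mathcal{G}')$ are isomorphic if there is a permutation $\sigma$ of $[n]$ with $\sigma(\mathcal{F})=\mathcal{F}'$ and $\sigma(\mathcal{G})=\mathcal{G}'$. Constructions: - $\mathcal{A}(k,t)=\{F\in\binom{[n]}{k}: |F\cap[t+2]|\geq t+1\}$. - $\mathcal{B}(k;(a_1,a_2,a_3,a_4))=[\{a_1,a_2\}\rangle_k\cup[\{a_2,a_3\}\rangle_k\cup[\{a_3,a_4\}\rangle_k$, for distinct $a_1,a_2,a_3,a_4\in[n]$. - $\mathcal{C}_1(\ell,t)=\{[\ell+1]\setminus\{i\}: i\in[t+1]\}\cup[[t+1]\rangle_\ell$. - $\mathcal{C}_2(k,t;\ell)=\{F\in\binom{[n]}{k}: |F\cap[t+1]|=t,\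 |F\cap[t+2,\ell+1]|\geq 1\}\cup[[t+1]\rangle_k$. - For $X\in\binom{[t+1,n]}{k-t+1}$ and $Y\in\binom{[t+1,n]}{\ell-t+1}$: $\mathcal{H}(k,t;X,Y)=\{F\in\binom{[n]}{k}: [t]\subseteq F,\ |F\cap Y|\geq 1\}\cup\{X\cup[t]\setminus\{i\}: i\in[t]\}$. (Thus $\mathcal{H}(\ell,t;Y,X)$ is the same construction with the roles of $(k,X)$ and $(\ell,Y)$ interchanged.) *)

(* Defs.v *)
From mathcomp Require Import all_boot all_fingroup.

Set Implicit Arguments.
Unset Strict Implicit.
Unset Printing Implicit Defensive.

(* The ground set {1, ..., n} is 'I_n, with i : 'I_n standing for the point   *)
(* i.+1; all numeric labels below are the 1-based ones.                       *)

Definition interval (n a b : nat) : {set 'I_n} := [set i : 'I_n | a <= i.+1 <= b].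

Definition points (n : nat) (s : seq nat) : {set 'I_n} :=
  [set i : 'I_n | i.+1 \in s].

Definition ksubsets (T : finType) (M : {set T}) (k : nat) : {set {set T}} :=
  [set A : {set T} | (A \subset M) && (#|A| == k)].

Definition star (n : nat) (S : {set 'I_n}) (k : nat) : {set {set 'I_n}} :=
  [set F in ksubsets [set: 'I_n] k | S \subset F].

Definition t_cover (T : finType) (t : nat) (FF : {set {set T}}) (C : {set T}) : bool :=
  [forall F in FF, t <= #|C :&: F|].

(* The default [set: T] of the arg min is a t-cover as soon as all members of *)
(* FF have at least t elements, so this is then the minimum size of a t-cover. *)
Definition tau (T : finType) (t : nat) (FF : {set {set T}}) : nat :=
  #|[arg min_(C < [set: T] | t_cover t FF C) #|C| ]|.

Definition cross_intersecting (T : finType) (t : nat) (FF GG : {set {set T}}) : Prop :=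
  forall F G : {set T}, F \in FF -> G \in GG -> t <= #|F :&: G|.

Definition perm_family (T : finType) (s : {perm T}) (FF : {set {set T}}) : {set {set T}} :=
  [set s @: F | F : {set T} in FF].

Definition isomorphic (T : finType) (P Q : {set {set T}} * {set {set T}}) : Prop :=
  exists s : {perm T}, perm_family s P.1 = Q.1 /\ perm_family s P.2 = Q.2.

Definition admissible (n k1 k2 t : nat) (F1 F2 : {set {set 'I_n}}) : Prop :=
  [/\ F1 \subset ksubsets [set: 'I_n] k1,
      F2 \subset ksubsets [set: 'I_n] k2,
      cross_intersecting t F1 F2,
      t + 1 <= tau t F1
    & t + 1 <= tau t F2].

Definition famA (n k t : nat) : {set {set 'I_n}} :=
  [set F in ksubsets [set: 'I_n] k | t + 1 <= #|F :&: interval n 1 (t + 2)|].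

Definition famB (n k a1 a2 a3 a4 : nat) : {set {set 'I_n}} :=
  star (points n [:: a1; a2]) k :|: star (points n [:: a2; a3]) k
    :|: star (points n [:: a3; a4]) k.

Definition famC1 (n l t : nat) : {set {set 'I_n}} :=
  [set interval n 1 (l + 1) :\ i | i in interval n 1 (t + 1)]
    :|: star (interval n 1 (t + 1)) l.

Definition famC2 (n k t l : nat) : {set {set 'I_n}} :=
  [set F in ksubsets [set: 'I_n] k |
     (#|F :&: interval n 1 (t + 1)| == t)
     && (1 <= #|F :&: interval n (t + 2) (l + 1)|)]
    :|: star (interval n 1 (t + 1)) k.

Definition famH (n k t : nat) (X Y : {set 'I_n}) : {set {set 'I_n}} :=
  [set F in ksubsets [set: 'I_n] k |
     (interval n 1 t \subset F) && (1 <= #|F :&: Y|)]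
    :|: [set X :|: interval n 1 t :\ i | i in interval n 1 t].

(* Main.v *)
Require Import Defs.
From mathcomp Require Import all_boot all_fingroup.
From mathcomp Require Import zify.

Set Implicit Arguments.
Unset Strict Implicit.
Unset Printing Implicit Defensive.

(** Call t-covers of size t+1 of F1 and F2 the next covers, and let p and q be
    their numbers; write N1 and N2 for the numbers of k1- and k2-sets above a
    fixed (t+1)-set. In an extremal pair F1 consists of all k1-sets that are
    t-covers of F2, so it contains the q stars over the next covers of F2;
    every other member is reached by picking t points of a next cover of F1 and
    branching twice, which gives few sets when n is large ([branching],
    [refined_bound]). Hence |F1| is about q * N1, |F2| is about p * N2, and the
    product is governed by the integer p * q. That covering numbers above t+1 do
    not occur follows from the same branching applied to the product
    ([extremal_covers]).

    The ground set is so large that all corrections amount to less than one unit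
    of N1 * N2 ([leading_comparison]). Each candidate pair therefore gives a
    lower bound on p * q: (t+2)^2 from the sets meeting a (t+2)-set in t+1
    points, (k1-t+1)(k2-t+1) from the pair built on a t-set with petals, and
    (t+1)(k1-t)+1 from the pair with a single star on one side. For k2 = t+1 the
    petals weigh as much as stars and the second bound improves to 2(k1+1).

    On the other side the two families of next covers are cross t-intersecting
    families of (t+1)-sets, which leaves few configurations. If both have at
    least three members and no two members of one family meet in fewer than t
    points, then all of them lie in one (t+2)-set, so p and q are at most t+2, or
    all contain one t-set W, so p and q are at most k1-t+1 and k2-t+1
    ([star_or_simplex]). Two members meeting in only t-1 points force the other
    family onto a two-by-two grid; then p * q is at most 9, which is enough only
    for t = 1, where the paths appear ([far_pair_case]). With one or two next
    covers on a side the other number is bounded by counting exchanges of one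
    point, and the bounds from the candidates leave the pair with a single star,
    and the petals for k2 = t+1 ([extremal_classification]). In each surviving
    case equality determines the next covers completely, these determine which
    sets can belong to F1 and F2, and maximality makes the resulting inclusions
    equalities. A permutation of the points then moves the configuration to the
    standard position. *)

(** * Subsets of a given size *)

Section SetCounting.
Variable T : finType.
Implicit Types (A B C F R S : {set T}) (k r : nat).

Lemma in_ksets k F : (F \in ksubsets [set: T] k) = (#|F| == k).
Proof. by rewrite inE subsetT. Qed.

Lemma cardsU_disj A B : [disjoint A & B] -> #|A :|: B| = #|A| + #|B|.
Proof. by move=> d; apply/eqP; rewrite (leq_card_setU A B).2. Qed.

Lemma leq_cardI A B A' B' : A \subset A' -> B \subset B' -> #|A :&: B| <= #|A' :&: B'|.
Proof. by move=> sA sB; apply/subset_leq_card/setISS. Qed.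

Lemma cards_setD1 A x : x \in A -> #|A :\ x| = #|A|.-1.
Proof. by move=> xA; rewrite (cardsD1 x A) xA. Qed.

Lemma subset_of_card A k : k <= #|A| -> exists2 B : {set T}, B \subset A & #|B| = k.
Proof.
case/(@card_geqP _ (mem A)) => s [us ss sA]; exists [set x in s].
  by apply/subsetP => x; rewrite inE; apply: sA.
by rewrite cardsE (card_uniqP us).
Qed.

Lemma extend_avoiding k R C : #|R| <= k -> k + #|C| <= #|T| ->
  exists2 F : {set T}, #|F| = k & R \subset F /\ F :&: C \subset R.
Proof.
move=> Rk kC.
have := cardsC (R :|: C); have := cardsUI R C => cU cC.
have [|B sB cB] := @subset_of_card (~: (R :|: C)) (k - #|R|); first by lia.
have dis : R :&: B = set0.
  apply/setP => x; rewrite !inE; apply/negP => /andP[xR xB].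
  by move/subsetP: sB => /(_ _ xB); rewrite !inE xR.
exists (R :|: B); first by have := cardsUI R B; rewrite dis cards0; lia.
split; first exact: subsetUl.
apply/subsetP => x; rewrite !inE => /andP[/orP[//|xB] xC].
by move/subsetP: sB => /(_ _ xB); rewrite !inE xC orbT.
Qed.

Lemma card_ksets_above k S : k <= #|T| ->
  #|[set F : {set T} | (#|F| == k) && (S \subset F)]| = 'C(#|T| - #|S|, #|T| - k).
Proof.
move=> kT; rewrite -(card_imset _ (@setC_inj T)).
have -> : #|T| - #|S| = #|~: S| by have := cardsC S; lia.
rewrite -cards_draws; apply: eq_card => B; rewrite [in RHS]inE.
apply/imsetP/andP => [[F]|[sB cB]].
  rewrite inE => /andP[/eqP cF SF] ->; rewrite setCS SF; split=> //.
  by apply/eqP; have := cardsC F; lia.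
exists (~: B); last by rewrite setCK.
rewrite inE -setCS setCK sB andbT; apply/eqP.
by have := cardsC B; have := max_card B; move/eqP: cB; lia.
Qed.

End SetCounting.

(** The number of k-subsets of an n-set above a fixed r-set; choosing the
    complement makes the formula right also for r > k, where it vanishes. *)
Definition above n k r := 'C(n - r, n - k).

Lemma aboveS n k r : k <= n -> above n k r.+1 * (n - r) = above n k r * (k - r).
Proof.
move=> kn; rewrite /above subnS mulnC mul_bin_down mulnC; congr (_ * _).
by have [rk|kr] := leqP r k; lia.
Qed.

Lemma above_gt0 n k r : r <= k -> k <= n -> 0 < above n k r.
Proof. by move=> rk kn; rewrite bin_gt0; lia. Qed.

(** * Covers and covering numbers *)

Section Covers.
Variables (T : finType) (t : nat).
Implicit Types (C F G S : {set T}) (FF GG : {set {set T}}).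

Lemma t_coverP FF C : reflect (forall F, F \in FF -> t <= #|C :&: F|) (t_cover t FF C).
Proof. exact: forall_inP. Qed.

Lemma t_cover_setT FF C : t_cover t FF C -> t_cover t FF [set: T].
Proof.
move=> /t_coverP hC; apply/t_coverP => F /hC; rewrite setTI => h.
exact: leq_trans h (subset_leq_card (subsetIr _ _)).
Qed.

Lemma tau_le FF C : t_cover t FF C -> tau t FF <= #|C|.
Proof.
move=> hC; rewrite /tau; case: arg_minnP; first exact: t_cover_setT hC.
by move=> D _ /(_ C hC).
Qed.

Lemma tau_attained FF C : t_cover t FF C -> exists2 D : {set T}, t_cover t FF D & #|D| = tau t FF.
Proof.
move=> hC; rewrite /tau; case: arg_minnP; first exact: t_cover_setT hC.
by move=> D hD _; exists D.
Qed.

Lemma not_cover_of_tau FF C : #|C| < tau t FF ->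
  exists2 F : {set T}, F \in FF & #|C :&: F| < t.
Proof.
move=> hC; have : ~~ t_cover t FF C by apply/negP => /tau_le; lia.
by rewrite negb_forall_in => /exists_inP[F FF_F hF]; exists F => //; rewrite ltnNge.
Qed.

Lemma tau_gt FF F0 : F0 \in FF -> (forall F, F \in FF -> t <= #|F|) ->
  (forall C, #|C| = t -> exists2 F : {set T}, F \in FF & #|C :&: F| < t) -> t + 1 <= tau t FF.
Proof.
move=> F0F big noC; rewrite addn1 ltnNge; apply/negP => small.
have [|D hD cD] := @tau_attained FF [set: T].
  by apply/t_coverP => F /big; rewrite setTI.
have {}cD : #|D| = t.
  apply/eqP; rewrite eqn_leq {1}cD small /=.
  apply: leq_trans (subset_leq_card (subsetIl D F0)).
  by move/t_coverP: hD; apply.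
have [F FF_F] := noC _ cD; rewrite ltnNge.
by move/t_coverP: hD => ->.
Qed.

Lemma t_coverS FF GG C : FF \subset GG -> t_cover t GG C -> t_cover t FF C.
Proof. by move=> sub /t_coverP hC; apply/t_coverP => F /(subsetP sub)/hC. Qed.

Lemma cover_above FF C (D : {set T}) : C \subset D -> t_cover t FF C -> t_cover t FF D.
Proof.
move=> sub /t_coverP hC; apply/t_coverP => F /hC h.
exact: leq_trans h (subset_leq_card (setSI _ sub)).
Qed.

(** Some G in GG meets S in fewer than t points. A cover above S misses at most
    k - t points of G, so it meets every (k - t + 1)-subset of G minus S. Having
    only k - t + 1 candidates, rather than the k points of G, is what makes the
    errors small enough below. *)
Lemma branching GG k S : t <= k -> GG \subset ksubsets [set: T] k -> ~~ t_cover t GG S ->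
  exists2 A : {set T}, #|A| = k - t + 1 /\ [disjoint A & S] &
    forall C, S \subset C -> t_cover t GG C -> exists2 x, x \in A & x |: S \subset C.
Proof.
move=> tk kG; rewrite negb_forall_in => /exists_inP[G GG_G hG].
have cG : #|G| = k by apply/eqP; rewrite -in_ksets; apply: (subsetP kG).
have := cardsID S G; rewrite [G :&: S]setIC => cD.
have [|A sA cA] := @subset_of_card _ (G :\: S) (k - t + 1); first by lia.
exists A.
  split=> //; rewrite disjoint_subset; apply/subsetP => x /(subsetP sA).
  by rewrite !inE => /andP[].
move=> C SC /t_coverP/(_ _ GG_G) hC.
have : (C :&: A) != set0.
  apply/eqP => CA0.
  have : #|C :&: G| + #|A| <= #|G|.
    have dis : (C :&: G) :&: A = set0 by rewrite setIAC CA0 set0I.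
    have := cardsUI (C :&: G) A; rewrite dis cards0.
    have : (C :&: G) :|: A \subset G.
      rewrite subUset subsetIr; apply: subset_trans sA _; exact: subsetDl.
    by move/subset_leq_card; lia.
  by lia.
case/set0Pn => x; rewrite inE => /andP[xC xA]; exists x => //.
by rewrite subUset sub1set xC.
Qed.

End Covers.

(** * Upper bounds from covers *)

Lemma union_bound (I T : finType) (A : {set I}) (FF : {set T}) (P : I -> pred T) c :
  (forall F, F \in FF -> exists2 i, i \in A & P i F) ->
  (forall i, i \in A -> #|[set F in FF | P i F]| <= c) -> #|FF| <= #|A| * c.
Proof.
move=> cov small.
have : #|FF| <= #|\bigcup_(i in A) [set F in FF | P i F]|.
  apply/subset_leq_card/subsetP => F FF_F; have [i iA PiF] := cov _ FF_F.
  by apply/bigcupP; exists i => //; rewrite inE FF_F.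
move=> /leq_trans; apply; rewrite -sum_nat_const.
apply: (@leq_trans (\sum_(i in A) #|[set F in FF | P i F]|)); last exact: leq_sum.
elim/big_rec2: _ => [|i y1 y2 _ h]; first by rewrite cards0.
by have := cardsUI [set F in FF | P i F] y2; lia.
Qed.

(** For a family with t-covering number t+1, the sets that cross t-intersect all
    of it are, up to lower order, those above one of these covers. *)
Definition next_covers (T : finType) t (GG : {set {set T}}) : {set {set T}} :=
  [set C : {set T} | (#|C| == t.+1) && t_cover t GG C].

Section UpperBounds.
Variables (T : finType) (t k1 k2 : nat) (FF GG : {set {set T}}).
Hypotheses (tk2 : t <= k2) (k1T : k1 <= #|T|).
Hypotheses (FFk : FF \subset ksubsets [set: T] k1) (GGk : GG \subset ksubsets [set: T] k2).
Hypothesis FG : forall F, F \in FF -> t_cover t GG F.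
Implicit Types (C F G H S : {set T}).

Lemma card_above_le S (HH : {set {set T}}) : HH \subset FF ->
  #|[set F in HH | S \subset F]| <= above #|T| k1 #|S|.
Proof.
move=> HF; rewrite /above -(card_ksets_above S k1T); apply/subset_leq_card/subsetP => F.
rewrite !inE => /andP[/(subsetP HF)/(subsetP FFk)]; rewrite in_ksets => -> -> //.
Qed.

Lemma branch_bound S : #|S| <= tau t GG ->
  #|[set F in FF | S \subset F]|
    <= (k2 - t + 1) ^ (tau t GG - #|S|) * above #|T| k1 (tau t GG).
Proof.
move: {2}(tau t GG - #|S|) (erefl (tau t GG - #|S|)) => d.
elim: d S => [|d IH] S hd hS.
  have -> : tau t GG = #|S| by lia.
  by rewrite subnn mul1n card_above_le.
have nS : ~~ t_cover t GG S by apply/negP => /tau_le; lia.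
have [A [cA dA] hA] := branching tk2 GGk nS.
rewrite hd expnS -mulnA -cA.
apply: (@union_bound _ _ _ _ (fun x F => x |: S \subset F)) => [F|x xA].
  by rewrite inE => /andP[/FG FG_F SF]; apply: hA.
have xS : x \notin S by rewrite (disjointFr dA xA).
have cxS : #|x |: S| = #|S|.+1 by rewrite cardsU1 xS.
have := IH (x |: S); rewrite cxS; have -> : tau t GG - #|S|.+1 = d by lia.
rewrite -cA; move=> /(_ erefl); move=> IH1.
apply: leq_trans (IH1 _); last by lia.
apply/subset_leq_card/subsetP => F; rewrite !inE.
by move=> /andP[/andP[-> _] ->].
Qed.

(** Each member of FF contains one of the t-subsets of C; from there one branches
    until the covering number of GG is reached. *)
Lemma family_bound C : t_cover t FF C -> t <= tau t GG ->
  #|FF| <= 'C(#|C|, t) * ((k2 - t + 1) ^ (tau t GG - t) * above #|T| k1 (tau t GG)).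
Proof.
move=> /t_coverP hC tG; rewrite -cards_draws.
apply: (@union_bound _ _ _ _ (fun H F => H \subset F)) => [F FF_F|H].
  have [H sH cH] := subset_of_card (hC _ FF_F).
  move: sH; rewrite subsetI => /andP[HC HF].
  by exists H; rewrite // inE HC cH eqxx.
rewrite inE => /andP[_ /eqP cH].
by have := @branch_bound H; rewrite cH => ->.
Qed.

(** The error term counts the members above no next cover of GG: they are found
    by choosing a t-subset of S and then branching twice. *)
Lemma refined_bound S : t_cover t FF S -> #|S| = t.+1 -> t < tau t GG ->
  #|FF| <= #|next_covers t GG| * above #|T| k1 t.+1
         + t.+1 * ((k2 - t + 1) ^ 2 * above #|T| k1 t.+2).
Proof.
move=> /t_coverP hS cS tG; set NC := next_covers t GG.
set rest := [set F in FF | [forall C in NC, ~~ (C \subset F)]].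
rewrite -(cardsID rest FF) addnC leq_add //.
  apply: (@union_bound _ _ _ _ (fun C F => C \subset F)) => [F|C].
    rewrite !inE => /andP[nrest FF_F]; move: nrest; rewrite FF_F /=.
    by rewrite negb_forall_in => /exists_inP[C ? /negPn ?]; exists C.
  rewrite inE => /andP[/eqP cC _]; rewrite -cC; apply: card_above_le.
  exact: subsetDl.
have -> : FF :&: rest = rest by apply/setIidPr/subsetP => F; rewrite inE => /andP[].
have restFF : rest \subset FF by apply/subsetP => F; rewrite inE => /andP[].
have cH : #|[set H : {set T} | (H \subset S) && (#|H| == t)]| = t.+1.
  by rewrite cards_draws cS binSn.
rewrite -[X in _ <= X * _]cH {cH}.
apply: (@union_bound _ _ _ _ (fun H F => H \subset F)) => [F|H].
  rewrite inE => /andP[FF_F _].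
  have [H sH cH] := subset_of_card (hS _ FF_F).
  move: sH; rewrite subsetI => /andP[HC HF].
  by exists H; rewrite // inE HC cH eqxx.
rewrite inE => /andP[_ /eqP cH].
have nH : ~~ t_cover t GG H by apply/negP => /tau_le; lia.
have [A [cA dA] hA] := branching tk2 GGk nH.
rewrite expnS expn1 -mulnA -{1}cA.
apply: (@union_bound _ _ _ _ (fun x F => x |: H \subset F)) => [F|x xA].
  by rewrite inE => /andP[/(subsetP restFF)/FG FG_F SF]; apply: hA.
have xH : x \notin H by rewrite (disjointFr dA xA).
have cxH : #|x |: H| = t.+1 by rewrite cardsU1 xH cH.
have [xHc|nxH] := boolP (t_cover t GG (x |: H)).
  rewrite (_ : [set F in _ | _] = set0) ?cards0 //.
  apply/setP => F; rewrite !inE; apply/negP => /andP[/andP[/andP[_ hF] _] sub].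
  move/forall_inP: hF => /(_ (x |: H)); rewrite inE cxH eqxx xHc sub.
  by move=> /(_ isT).
have [B [cB dB] hB] := branching tk2 GGk nxH.
rewrite -cB.
apply: (@union_bound _ _ _ _ (fun y F => y |: (x |: H) \subset F)) => [F|y yB].
  rewrite !inE => /andP[/andP[/andP[/FG FG_F _] _] sub]; exact: hB.
have <- : #|y |: (x |: H)| = t.+2 by rewrite cardsU1 (disjointFr dB yB) cxH.
apply: card_above_le; apply/subsetP => F; rewrite !inE.
by move=> /andP[/andP[/andP[-> _] _] _].
Qed.

End UpperBounds.

(** * Lower bounds from stars *)

Section LowerBound.
Variables (T : finType) (t k : nat).
Hypothesis kT : k <= #|T|.
Implicit Types (F R : {set T}) (RR FF : {set {set T}}).

Lemma card_above_two R R' : #|R| = t.+1 -> #|R'| = t.+1 -> R != R' ->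
  #|[set F : {set T} | [&& #|F| == k, R \subset F & R' \subset F]]| <= above #|T| k t.+2.
Proof.
move=> cR cR' neq.
have [|U sU cU] := @subset_of_card _ (R :|: R') t.+2.
  rewrite ltnNge; apply/negP => h.
  have e : R = R :|: R' by apply/eqP; rewrite eqEcard subsetUl cR.
  have e' : R' = R :|: R' by apply/eqP; rewrite eqEcard subsetUr cR'.
  by move: neq; rewrite {1}e -e' eqxx.
rewrite /above -cU -(card_ksets_above U kT); apply/subset_leq_card/subsetP => F.
rewrite !inE => /and3P[-> RF R'F]; apply: subset_trans sU _.
by rewrite subUset RF.
Qed.

(** Bonferroni: the stars over two distinct (t+1)-sets share only sets above some
    (t+2)-set. *)
Lemma stars_lower_bound RR FF : (forall R, R \in RR -> #|R| = t.+1) ->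
  (forall R F, R \in RR -> R \subset F -> #|F| = k -> F \in FF) ->
  #|RR| * above #|T| k t.+1 <= #|FF| + #|RR| * #|RR|.-1 * above #|T| k t.+2.
Proof.
move=> cRR starFF.
pose st (QQ : {set {set T}}) :=
  [set F : {set T} | (#|F| == k) && [exists R in QQ, R \subset F]].
have sub : st RR \subset FF.
  apply/subsetP => F; rewrite inE => /andP[/eqP cF /exists_inP[R RR_R RF]].
  exact: (starFF R).
apply: leq_trans (leq_add (subset_leq_card sub) (leqnn _)).
have [d] := ubnP #|RR|; elim: d RR cRR {starFF sub} => // d IH RR cRR hd.
have [->|[R RR_R]] := set_0Vmem RR; first by rewrite cards0.
have cRR' : #|RR| = (#|RR :\ R|).+1 by rewrite (cardsD1 R RR) RR_R.
have {}IH : #|RR :\ R| * above #|T| k t.+1 <= #|st (RR :\ R)|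
     + #|RR :\ R| * #|RR :\ R|.-1 * above #|T| k t.+2.
  by apply: IH => [Q|]; [rewrite inE => /andP[_ /cRR] | lia].
pose sR := [set F : {set T} | (#|F| == k) && (R \subset F)].
have csR : #|sR| = above #|T| k t.+1 by rewrite /sR card_ksets_above // cRR.
have inter : #|sR :&: st (RR :\ R)| <= #|RR :\ R| * above #|T| k t.+2.
  apply: (@union_bound _ _ (RR :\ R) _ (fun (Q F : {set T}) => Q \subset F)) => [F|Q QR].
    by rewrite !inE => /andP[_ /andP[_ /exists_inP[Q ? ?]]]; exists Q.
  have [QneR QRR] : Q != R /\ Q \in RR by apply/andP; rewrite -in_setD1.
  have := @card_above_two Q R (cRR _ QRR) (cRR _ RR_R) QneR; apply: leq_trans.
  apply/subset_leq_card/subsetP => F; rewrite !inE.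
  by move=> /andP[/andP[/andP[-> ->] _] ->].
have union : #|sR :|: st (RR :\ R)| <= #|st RR|.
  apply/subset_leq_card/subsetP => F; rewrite !inE.
  case/orP => /andP[-> /=]; first by move=> RF; apply/exists_inP; exists R.
  by case/exists_inP => Q; rewrite inE => /andP[_ QRR] QF; apply/exists_inP; exists Q.
have := cardsUI sR (st (RR :\ R)); rewrite csR cRR' /=.
move: IH inter union; set a := above _ _ _; set b := above _ _ _.
case: #|RR :\ R| => [|e] /=; nia.
Qed.

End LowerBound.

(** Here u1, u2 are sizes bounded from above by q * N1 and p * N2, and v1, v2 sizes
    bounded from below by e1 * N1 and e2 * N2, up to corrections smaller by a
    factor of order m. Measured in N1 * N2, the corrections to u1 * u2 sum to at
    most 1/4 + 1/4 + 1/16 and those to v1 * v2 to at most 1/3, less than 1 in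
    total, so that the integers p * q and e1 * e2 compare like the products. *)
Lemma leading_comparison m D N1 N1' N2 N2' d1 d2 u1 u2 v1 v2 p q e1 e2 M1 M2 E1 E2 :
  0 < N1 -> 0 < N2 -> N1' * m = N1 * d1 -> N2' * m = N2 * d2 -> 0 < p -> 0 < q ->
  u1 <= q * N1 + M1 * N1' -> u2 <= p * N2 + M2 * N2' ->
  e1 * N1 <= v1 + E1 * N1' -> e2 * N2 <= v2 + E2 * N2' -> v1 * v2 <= u1 * u2 ->
  4 * (p * (M1 * d1)) <= D -> 4 * (q * (M2 * d2)) <= D ->
  3 * (e1 * (E2 * d2) + e2 * (E1 * d1)) <= D -> D < m ->
  e1 * e2 <= p * q.
Proof.
move=> N1p N2p h1 h2 p0 q0 hu1 hu2 hv1 hv2 hv.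
have [x1 ex1] : exists x, x = M1 * d1 by eexists.
have [x2 ex2] : exists x, x = M2 * d2 by eexists.
have [y1 ey1] : exists y, y = E1 * d1 by eexists.
have [y2 ey2] : exists y, y = E2 * d2 by eexists.
rewrite -ex1 -ex2 -ey1 -ey2.
move=> hx1 hx2 hy hD.
rewrite leqNgt; apply/negP => lt.
have mu1 : u1 * m <= N1 * (q * m + x1).
  apply: (@leq_trans ((q * N1 + M1 * N1') * m)); first by rewrite leq_mul2r hu1 orbT.
  by rewrite mulnDl -(mulnA M1) h1 ex1; lia.
have mu2 : u2 * m <= N2 * (p * m + x2).
  apply: (@leq_trans ((p * N2 + M2 * N2') * m)); first by rewrite leq_mul2r hu2 orbT.
  by rewrite mulnDl -(mulnA M2) h2 ex2; lia.
have e10 : 0 < e1 by case: (e1) lt => //; lia.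
have e20 : 0 < e2 by case: (e2) lt => //; lia.
have y1m : y1 <= e1 * m by nia.
have y2m : y2 <= e2 * m by nia.
have [a ha] : exists a, e1 * m = y1 + a by exists (e1 * m - y1); lia.
have [b hb] : exists b, e2 * m = y2 + b by exists (e2 * m - y2); lia.
have mv1 : N1 * a <= v1 * m.
  have : e1 * N1 * m <= (v1 + E1 * N1') * m by rewrite leq_mul2r hv1 orbT.
  rewrite mulnDl -(mulnA E1) h1 mulnAC ha; move: ey1; nia.
have mv2 : N2 * b <= v2 * m.
  have : e2 * N2 * m <= (v2 + E2 * N2') * m by rewrite leq_mul2r hv2 orbT.
  rewrite mulnDl -(mulnA E2) h2 mulnAC hb; move: ey2; nia.
have prod : (N1 * N2) * (a * b) <= (N1 * N2) * ((q * m + x1) * (p * m + x2)).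
  apply: (@leq_trans ((v1 * m) * (v2 * m))).
    by rewrite mulnACA leq_mul.
  apply: (@leq_trans ((u1 * m) * (u2 * m))).
    by rewrite !(mulnACA _ m) leq_mul.
  by rewrite (mulnACA N1) leq_mul.
have {}prod : a * b <= (q * m + x1) * (p * m + x2).
  by move: prod; rewrite leq_pmul2l // muln_gt0 N1p.
have lower : e1 * e2 * (m * m) <= a * b + m * (e1 * y2 + e2 * y1).
  have -> : e1 * e2 * (m * m) = (e1 * m) * (e2 * m) by lia.
  have : m * (e1 * y2 + e2 * y1) = (e1 * m) * y2 + (e2 * m) * y1 by lia.
  by rewrite ha hb => ->; nia.
have xx : 16 * (x1 * x2) <= D * D.
  have a1 : 4 * x1 <= D by nia.
  have a2 : 4 * x2 <= D by nia.
  by have := leq_mul a1 a2; lia.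
have DD : D * D <= D * m by nia.
have big : (p * q).+1 * (m * m) <= e1 * e2 * (m * m) by rewrite leq_mul2r lt orbT.
have mD : m * (4 * (p * x1)) <= m * D by rewrite leq_mul2l hx1 orbT.
have mD2 : m * (4 * (q * x2)) <= m * D by rewrite leq_mul2l hx2 orbT.
have mD3 : m * (3 * (e1 * y2 + e2 * y1)) <= m * D by rewrite leq_mul2l hy orbT.
have Dm : m * D < m * m by rewrite ltn_mul2l hD andbT; lia.
move: prod lower big mD mD2 mD3 Dm xx DD.
have -> : (q * m + x1) * (p * m + x2)
    = p * q * (m * m) + m * (q * x2) + m * (p * x1) + x1 * x2 by lia.
rewrite mulSn !(mulnCA m).
lia.
Qed.

(** * The candidate pairs *)

Definition nontrivial_pair (T : finType) k1 k2 t (F1 F2 : {set {set T}}) : Prop :=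
  [/\ F1 \subset ksubsets [set: T] k1, F2 \subset ksubsets [set: T] k2,
      cross_intersecting t F1 F2, t + 1 <= tau t F1 & t + 1 <= tau t F2].

Lemma nontrivial_pair_sym (T : finType) k1 k2 t (F1 F2 : {set {set T}}) :
  nontrivial_pair k1 k2 t F1 F2 -> nontrivial_pair k2 k1 t F2 F1.
Proof. by case=> ? ? cr ? ?; split=> // F G hF hG; rewrite setIC; apply: cr. Qed.

Section Constructions.
Variable T : finType.
Implicit Types (S W X Y Z : {set T}).

(** The constructions are set up over arbitrary sets in place of initial
    intervals, so that they can be recognised before any relabelling. *)
Definition genA k t Z : {set {set T}} :=
  [set F in ksubsets [set: T] k | t + 1 <= #|F :&: Z|].

Definition genStar S k : {set {set T}} := [set F in ksubsets [set: T] k | S \subset F].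

Definition genB k (a b c d : T) : {set {set T}} :=
  genStar [set a; b] k :|: genStar [set b; c] k :|: genStar [set c; d] k.

Definition genC1 l S X : {set {set T}} := [set (S :|: X) :\ i | i in S] :|: genStar S l.

Definition genC2 k t S X : {set {set T}} :=
  [set F in ksubsets [set: T] k | (#|F :&: S| == t) && (1 <= #|F :&: X|)]
    :|: genStar S k.

Definition genH k W X Y : {set {set T}} :=
  [set F in ksubsets [set: T] k | (W \subset F) && (1 <= #|F :&: Y|)]
    :|: [set X :|: W :\ i | i in W].

End Constructions.

Section Admissibility.
Variables (T : finType) (t : nat).
Implicit Types (C F G S W X Y Z R : {set T}) (FF GG RR : {set {set T}}).

(** A t-cover of a family containing whole stars has to contain t points of
    every centre, since the star over R has members that avoid the cover
    outside R. *)
Lemma tau_gt_stars k FF RR R0 : t < k -> k + t <= #|T| ->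
  FF \subset ksubsets [set: T] k -> R0 \in RR ->
  (forall R F, R \in RR -> R \subset F -> #|F| = k -> F \in FF) ->
  (forall R, R \in RR -> #|R| = t.+1) ->
  (forall C, #|C| = t -> (forall R, R \in RR -> C \subset R) ->
     exists2 F, F \in FF & #|C :&: F| < t) ->
  t + 1 <= tau t FF.
Proof.
move=> tk kT FFk R0RR starFF cRR noC.
have [||F0 cF0 [RF0 _]] := @extend_avoiding T k R0 set0.
- by rewrite cRR.
- by rewrite cards0; lia.
apply: (@tau_gt _ _ _ F0); first exact: (starFF R0).
  by move=> F /(subsetP FFk); rewrite in_ksets => /eqP ->; lia.
move=> C cC; have [/forall_inP|] := boolP [forall R in RR, C \subset R].
  exact: noC.
rewrite negb_forall_in => /exists_inP[R RRR nCR].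
have [||F cF [RF FC]] := @extend_avoiding T k R C.
- by rewrite cRR.
- by rewrite cC.
exists F; first exact: (starFF R).
rewrite -cC; apply: proper_card; rewrite properE subsetIl /=.
apply/negP => CCF; move/negP: nCR; apply; apply: subset_trans FC.
by rewrite setIC.
Qed.

Section PairA.
Variable Z : {set T}.

Lemma genA_star k R F : #|R| = t.+1 -> R \subset Z -> R \subset F -> #|F| = k -> F \in genA k t Z.
Proof.
move=> cR RZ RF cF; rewrite inE in_ksets cF eqxx /= addn1 -cR.
by apply: subset_leq_card; rewrite subsetI RF.
Qed.

Hypothesis cZ : #|Z| = t + 2.

Lemma genA_pair k1 k2 : 0 < t -> t < k1 -> t < k2 -> k1 + t <= #|T| -> k2 + t <= #|T| ->
  nontrivial_pair k1 k2 t (genA k1 t Z) (genA k2 t Z).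
Proof.
move=> t0 tk1 tk2 k1T k2T.
have tauA k : t < k -> k + t <= #|T| -> t + 1 <= tau t (genA k t Z).
  move=> tk kT.
  have [|R0 R0Z cR0] := @subset_of_card _ Z t.+1; first by rewrite cZ; lia.
  apply: (@tau_gt_stars k _ [set R : {set T} | (R \subset Z) && (#|R| == t.+1)] R0) => //.
  - by apply/subsetP => F; rewrite inE => /andP[].
  - by rewrite inE R0Z cR0 eqxx.
  - by move=> R F; rewrite inE => /andP[RZ /eqP cR]; apply: genA_star.
  - by move=> R; rewrite inE => /andP[_ /eqP].
  move=> C cC hC; exfalso.
  have CZ : C \subset Z by apply: subset_trans (R0Z); apply: hC; rewrite inE R0Z cR0 eqxx.
  have [c cC0] : exists c, c \in C by apply/set0Pn; rewrite -cards_eq0 cC; lia.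
  have := hC (Z :\ c); rewrite inE subsetDl cards_setD1 ?(subsetP CZ) // cZ.
  rewrite addn2 eqxx => /(_ isT)/subsetP/(_ _ cC0); by rewrite !inE eqxx.
split; [| | |exact: tauA|exact: tauA].
- by apply/subsetP => F; rewrite inE => /andP[].
- by apply/subsetP => F; rewrite inE => /andP[].
move=> F G; rewrite !inE => /andP[_ hF] /andP[_ hG].
apply: (@leq_trans #|(F :&: Z) :&: (G :&: Z)|); last by apply: leq_cardI; apply: subsetIl.
have := cardsUI (F :&: Z) (G :&: Z).
have : #|(F :&: Z) :|: (G :&: Z)| <= #|Z| by rewrite subset_leq_card // subUset !subsetIr.
by lia.
Qed.

Lemma genA_lower k : k <= #|T| -> (t + 2) * above #|T| k t.+1
  <= #|genA k t Z| + (t + 2) * (t + 1) * above #|T| k t.+2.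
Proof.
move=> kT.
have cRR : #|[set R : {set T} | (R \subset Z) && (#|R| == t.+1)]| = t + 2.
  by rewrite cards_draws cZ addn2 binSn.
have := @stars_lower_bound T t k kT [set R : {set T} | (R \subset Z) && (#|R| == t.+1)]
  (genA k t Z); rewrite cRR (_ : (t + 2).-1 = t + 1); last by lia.
apply=> [R|R F]; first by rewrite inE => /andP[_ /eqP].
by rewrite inE => /andP[RZ /eqP cR]; apply: genA_star.
Qed.

End PairA.

Section PairC.
Variables (S X : {set T}).
Hypotheses (cS : #|S| = t + 1) (dSX : [disjoint S & X]).

(** The centres of the stars that fill [genC2]. *)
Definition starsC : {set {set T}} := S |: [set x.2 |: S :\ x.1 | x in setX S X].

Lemma starsC_card R : R \in starsC -> #|R| = t.+1.
Proof.
case/setU1P => [->|]; first by rewrite cS addn1.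
case/imsetP => -[i x]; rewrite inE /= => /andP[iS xX] ->.
rewrite cardsU1 cards_setD1 // cS !inE (disjointFl dSX xX) andbF; lia.
Qed.

Lemma genC2_star k R F : R \in starsC -> R \subset F -> #|F| = k -> F \in genC2 k t S X.
Proof.
move=> RR RF cF; rewrite inE; apply/orP.
have [SF|nSF] := boolP (S \subset F); first by right; rewrite inE in_ksets cF eqxx SF.
left; rewrite inE in_ksets cF eqxx /=.
case/setU1P: RR => [eR|]; first by rewrite -eR RF in nSF.
case/imsetP => -[i x]; rewrite inE /= => /andP[iS xX] eR.
move: RF; rewrite eR subUset sub1set => /andP[xF SiF].
have : S :\ i \subset F :&: S by rewrite subsetI SiF subsetDl.
move/subset_leq_card; rewrite cards_setD1 // cS => h.
have : F :&: S \proper S.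
  by rewrite properE subsetIr /=; apply/negP; rewrite subsetI (negPf nSF).
move/proper_card; rewrite cS => h'.
apply/andP; split; first by apply/eqP; lia.
by apply/card_gt0P; exists x; rewrite inE xF.
Qed.

Lemma card_starsC : #|starsC| = (t + 1) * #|X| + 1.
Proof.
rewrite cardsU1 card_in_imset.
  rewrite cardsX cS; suff -> : S \notin [set x.2 |: S :\ x.1 | x in setX S X] by lia.
  apply/imsetP => -[[i x]]; rewrite inE /= => /andP[iS xX] eS.
  have : x \in S by rewrite eS !inE eqxx.
  by rewrite (disjointFl dSX xX).
move=> [i x] [j y]; rewrite !inE /= => /andP[iS xX] /andP[jS yX] e.
have xS := disjointFl dSX xX; have yS := disjointFl dSX yX.
congr (_, _).
  apply/eqP/negPn/negP => ij.
  have : i \in y |: S :\ j by rewrite !inE ij iS orbT.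
  by rewrite -e !inE eqxx /= orbF => /eqP ix; rewrite -ix iS in xS.
have : x \in y |: S :\ j by rewrite -e !inE eqxx.
by rewrite !inE xS andbF orbF => /eqP.
Qed.

Lemma genC1_lower k : k <= #|T| -> above #|T| k t.+1 <= #|genC1 k S X|.
Proof.
move=> kT; rewrite /above (_ : t.+1 = #|S|); last by rewrite cS addn1.
rewrite -card_ksets_above //.
apply/subset_leq_card/subsetP => F; rewrite !inE subsetT /= => ->.
by rewrite orbT.
Qed.

Lemma genC2_lower k : k <= #|T| ->
  ((t + 1) * #|X| + 1) * above #|T| k t.+1 <= #|genC2 k t S X|
    + ((t + 1) * #|X| + 1) * ((t + 1) * #|X|) * above #|T| k t.+2.
Proof.
move=> kT; have := stars_lower_bound kT starsC_card (@genC2_star k).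
by rewrite card_starsC addn1.
Qed.

Lemma card_petalC k i : t < k -> #|X| = k - t -> i \in S -> #|(S :|: X) :\ i| = k.
Proof.
move=> tk cX iS; rewrite cards_setD1 ?inE ?iS // cardsU_disj // cS cX; lia.
Qed.

Lemma genC_pair k1 k2 : 0 < t -> t < k1 -> t < k2 -> k1 + t <= #|T| -> k2 + t <= #|T| ->
  #|X| = k1 - t -> nontrivial_pair k1 k2 t (genC1 k1 S X) (genC2 k2 t S X).
Proof.
move=> t0 tk1 tk2 k1T k2T cX.
have [x xX] : exists x, x \in X by apply/set0Pn; rewrite -cards_eq0 cX; lia.
split.
- apply/subsetP => F; rewrite !inE subsetT /= => /orP[/imsetP[i iS ->]|/andP[]//].
  by rewrite (card_petalC tk1).
- by apply/subsetP => F; rewrite !inE => /orP[] /andP[].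
- move=> F G; rewrite inE => /orP[/imsetP[i iS ->]|].
    rewrite inE => /orP[|]; rewrite !inE.
      case/andP => _ /andP[/eqP cGS cGX].
      have := @cardsU_disj _ (G :&: S :\ i) (G :&: X).
      rewrite -setI_eq0 => cU.
      have {}cU : #|(G :&: S :\ i) :|: (G :&: X)| = #|G :&: S :\ i| + #|G :&: X|.
        apply: cU; apply/eqP/setP => y; rewrite !inE; apply/negP.
        move=> /andP[/and3P[_ _ yS] /andP[_ yX]].
        by rewrite (disjointFl dSX yX) in yS.
      have := cardsD1 i (G :&: S); rewrite cGS => c1.
      apply: (@leq_trans #|(G :&: S :\ i) :|: (G :&: X)|).
        by rewrite cU; case: (i \in _) c1; lia.
      apply/subset_leq_card/subsetP => y; rewrite !inE.
      case/orP => [/and3P[-> -> ->]|/andP[-> yX]]; rewrite // yX orbT andbT.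
      by apply/andP; split=> //; apply/eqP => yi; rewrite -yi (disjointFl dSX yX) in iS.
    case/andP => _ SG; apply: (@leq_trans #|S :\ i|).
      by rewrite cards_setD1 // cS; lia.
    apply/subset_leq_card/subsetP => y; rewrite !inE => /andP[-> yS].
    by rewrite yS (subsetP SG).
  rewrite inE => /andP[_ SF]; rewrite inE => /orP[|]; rewrite !inE.
    case/andP => _ /andP[/eqP <- _]; rewrite setIC; exact: leq_cardI.
  case/andP => _ SG; apply: (@leq_trans #|S|); first by rewrite cS; lia.
  by apply: subset_leq_card; rewrite subsetI SF.
- apply: (@tau_gt_stars k1 _ [set S] S) => //.
  + apply/subsetP => F; rewrite !inE subsetT /= => /orP[/imsetP[i iS ->]|/andP[]//].
    by rewrite (card_petalC tk1).
  + by rewrite inE.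
  + by move=> R F; rewrite inE => /eqP -> SF cF; rewrite inE !inE subsetT cF eqxx SF orbT.
  + by move=> R; rewrite inE => /eqP ->; rewrite cS addn1.
  move=> C cC /(_ S); rewrite inE eqxx => /(_ isT) CS.
  have [i iC] : exists i, i \in C by apply/set0Pn; rewrite -cards_eq0 cC; lia.
  exists ((S :|: X) :\ i).
    by rewrite inE; apply/orP; left; apply/imsetP; exists i => //; apply: (subsetP CS).
  rewrite -[ltnRHS]cC; apply: proper_card; rewrite properE subsetIl /=.
  by apply/subsetPn; exists i; rewrite // !inE eqxx andbF.
apply: (@tau_gt_stars k2 _ starsC S) => //.
- by apply/subsetP => F; rewrite !inE => /orP[] /andP[].
- by rewrite setU11.
- by move=> R F; apply: genC2_star.
- exact: starsC_card.
move=> C cC hC; exfalso.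
have CS : C \subset S by apply: hC; rewrite setU11.
have [i iC] : exists i, i \in C by apply/set0Pn; rewrite -cards_eq0 cC; lia.
have iS := subsetP CS _ iC.
have := hC (x |: S :\ i); rewrite !inE => /(_ _)/subsetP/(_ i).
rewrite !inE eqxx iC /= orbF => h.
have /eqP ix : i == x.
  apply: h => //; apply/orP; right; apply/imsetP; exists (i, x) => //.
  by rewrite inE /= iS.
by rewrite ix (disjointFl dSX xX) in iS.
Qed.

End PairC.

Section PairH.
Variables (W : {set T}).
Hypothesis cW : #|W| = t.

Lemma card_petalH k X i : 0 < t -> t < k -> #|X| = k - t + 1 -> [disjoint W & X] -> i \in W ->
  #|X :|: W :\ i| = k.
Proof.
move=> t0 tk cX dX iW; rewrite setUC cardsU_disj ?cards_setD1 ?cW ?cX //; first by lia.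
by apply: disjointWl dX; apply: subsetDl.
Qed.

Lemma genH_sub k X Y : 0 < t -> t < k -> #|X| = k - t + 1 -> [disjoint W & X] ->
  genH k W X Y \subset ksubsets [set: T] k.
Proof.
move=> t0 tk cX dX; apply/subsetP => F; rewrite !inE subsetT /=.
by case/orP => [/andP[]//|/imsetP[i iW ->]]; rewrite (card_petalH t0 tk).
Qed.

Definition starsH Y : {set {set T}} := [set y |: W | y in Y].

Lemma starsH_card Y R : [disjoint W & Y] -> R \in starsH Y -> #|R| = t.+1.
Proof.
by move=> dY /imsetP[y yY ->]; rewrite cardsU1 cW (disjointFl dY yY).
Qed.

Lemma card_starsH Y : [disjoint W & Y] -> #|starsH Y| = #|Y|.
Proof.
move=> dY; apply: card_in_imset => y z yY zY e.
have : y \in z |: W by rewrite -e !inE eqxx.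
by rewrite !inE (disjointFl dY yY) orbF => /eqP.
Qed.

Lemma genH_star k X Y R F : R \in starsH Y -> R \subset F -> #|F| = k -> F \in genH k W X Y.
Proof.
move=> /imsetP[y yY ->] RF cF; rewrite inE; apply/orP; left.
move: RF; rewrite subUset sub1set => /andP[yF WF].
rewrite inE in_ksets cF eqxx WF /=; apply/card_gt0P.
by exists y; rewrite inE yF.
Qed.

Lemma genH_tau k X Y : 0 < t -> t < k -> k + t <= #|T| -> #|X| = k - t + 1 -> 2 <= #|Y| ->
  [disjoint W & X] -> [disjoint W & Y] -> t + 1 <= tau t (genH k W X Y).
Proof.
move=> t0 tk kT cX cY dX dY.
have [y yY] : exists y, y \in Y by apply/set0Pn; rewrite -cards_eq0; lia.
have [z] : exists z, z \in Y :\ y.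
  by apply/set0Pn; rewrite -cards_eq0; have := cards_setD1 yY; lia.
rewrite !inE => /andP[zy zY].
apply: (@tau_gt_stars k _ (starsH Y) (y |: W)) => //.
- exact: genH_sub.
- by apply/imsetP; exists y.
- by move=> R F; apply: genH_star.
- by move=> R; apply: starsH_card.
move=> C cC hC.
have Cy : C \subset y |: W by apply: hC; apply/imsetP; exists y.
have Cz : C \subset z |: W by apply: hC; apply/imsetP; exists z.
have CW : C = W.
  apply/eqP; rewrite eqEcard cC cW leqnn andbT; apply/subsetP => c cC'.
  move: (subsetP Cy _ cC') (subsetP Cz _ cC'); rewrite !inE.
  by case/orP => // /eqP ->; rewrite eq_sym (negPf zy).
have [w wW] : exists w, w \in W by apply/set0Pn; rewrite -cards_eq0 cW; lia.
exists (X :|: W :\ w); first by rewrite inE; apply/orP; right; apply/imsetP; exists w.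
rewrite -cC CW; apply: proper_card; rewrite properE subsetIl /=.
by apply/subsetPn; exists w; rewrite // !inE eqxx (disjointFr dX wW) andbF.
Qed.

Lemma genH_pair k1 k2 X Y : 0 < t -> t < k1 -> t < k2 -> k1 + t <= #|T| -> k2 + t <= #|T| ->
  #|X| = k1 - t + 1 -> #|Y| = k2 - t + 1 -> [disjoint W & X] -> [disjoint W & Y] ->
  minn t 2 <= #|X :&: Y| ->
  nontrivial_pair k1 k2 t (genH k1 W X Y) (genH k2 W Y X).
Proof.
move=> t0 tk1 tk2 k1T k2T cX cY dX dY hXY.
split; [exact: genH_sub|exact: genH_sub| |apply: genH_tau => //; lia|apply: genH_tau => //; lia].
(* W minus i contributes t - 1 common points and V at least one more *)
have mixed F (V : {set T}) i : [disjoint W & V] -> i \in W -> W \subset F -> 0 < #|F :&: V| ->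
  t <= #|F :&: (V :|: W :\ i)|.
  move=> dV iW WF /card_gt0P[y]; rewrite inE => /andP[yF yV].
  apply: (@leq_trans #|y |: W :\ i|).
    by rewrite cardsU1 cards_setD1 // cW !inE (disjointFl dV yV) andbF; lia.
  apply/subset_leq_card; rewrite subUset sub1set !inE yF yV /=.
  apply/subsetP => z; rewrite !inE => /andP[-> zW].
  by rewrite zW (subsetP WF) // orbT.
move=> F G; rewrite inE => /orP[|/imsetP[i iW ->]].
  rewrite inE => /andP[_ /andP[WF FY]]; rewrite inE => /orP[|/imsetP[j jW ->]].
    rewrite inE => /andP[_ /andP[WG _]]; rewrite -cW; apply: subset_leq_card.
    by rewrite subsetI WF.
  exact: mixed.
rewrite inE => /orP[|/imsetP[j jW ->]].
  by rewrite inE => /andP[_ /andP[WG GX]]; rewrite setIC; apply: mixed.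
apply: (@leq_trans #|(X :&: Y) :|: (W :\ i :\ j)|).
  rewrite cardsU_disj; last first.
    rewrite disjoint_sym; apply: (@disjointWl _ _ (mem W)).
      by apply: subset_trans (subsetDl _ _) (subsetDl _ _).
    by apply: disjointWr dX; apply: subsetIl.
  have := cardsD1 i W; have := cardsD1 j (W :\ i); rewrite iW cW.
  by move: hXY; rewrite /minn; case: ltnP; case: (j \in _); lia.
apply/subset_leq_card/subsetP => y; rewrite !inE.
by case/orP => [/andP[-> ->]//|/and3P[-> -> ->]]; rewrite !orbT.
Qed.

Lemma genH_lower k X Y : k <= #|T| -> [disjoint W & Y] ->
  #|Y| * above #|T| k t.+1 <= #|genH k W X Y| + #|Y| * #|Y|.-1 * above #|T| k t.+2.
Proof.
move=> kT dY; rewrite -(card_starsH dY); apply: stars_lower_bound => //.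
  by move=> R; apply: starsH_card.
by move=> R F; apply: genH_star.
Qed.

(** For k = t + 1 each star is a single set, so the t petals are no longer
    negligible. *)
Lemma genH_lower_small X Y : #|X| = 2 -> [disjoint W & X] -> [disjoint W & Y] ->
  #|Y| + t <= #|genH t.+1 W X Y|.
Proof.
move=> cX dX dY.
have cP : #|[set X :|: W :\ i | i in W]| = t.
  rewrite card_in_imset // => i j iW jW e; apply/eqP/negPn/negP => ij.
  have : i \in X :|: W :\ j by rewrite !inE ij iW orbT.
  by rewrite -e !inE eqxx orbF (disjointFr dX iW).
rewrite -(card_starsH dY) -[X in _ + X]cP -cardsU_disj.
  apply/subset_leq_card/subsetP => F; rewrite [in X in X -> _]inE.
  case/orP => [hF|hF]; last by rewrite inE hF orbT.
  exact: genH_star hF _ (starsH_card dY hF).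
apply/pred0P => F /=; apply/negP => /andP[/imsetP[y yY ->] /imsetP[i iW e]].
have : i \in y |: W by rewrite !inE iW orbT.
by rewrite e !inE eqxx orbF (disjointFr dX iW).
Qed.

End PairH.

Definition edgesB (a b c d : T) : {set {set T}} := [set [set a; b]; [set b; c]; [set c; d]].

Lemma genB_star (a b c d : T) k R F :
  R \in edgesB a b c d -> R \subset F -> #|F| = k -> F \in genB k a b c d.
Proof.
by rewrite !inE => /orP[/orP[]|] /eqP <- RF ->; rewrite subsetT RF eqxx ?orbT.
Qed.

Lemma genB_pair k1 k2 (a b c d : T) : t = 1 -> uniq [:: a; b; c; d] ->
  t < k1 -> t < k2 -> k1 + t <= #|T| -> k2 + t <= #|T| ->
  nontrivial_pair k1 k2 t (genB k1 a c b d) (genB k2 a b c d).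
Proof.
move=> t1 u tk1 tk2 k1T k2T.
have tauB k (x y z w : T) : uniq [:: x; y; z; w] -> t < k -> k + t <= #|T| ->
  t + 1 <= tau t (genB k x y z w).
  rewrite /= !inE !negb_or => /and4P[/and3P[xy xz xw] /andP[yz yw] zw _] tk kT.
  apply: (@tau_gt_stars k _ (edgesB x y z w) [set x; y]) => //.
  - by apply/subsetP => F; rewrite !inE => /orP[/orP[]|] /andP[].
  - by rewrite !inE eqxx.
  - by move=> R F; apply: genB_star.
  - by move=> R; rewrite !inE t1 => /orP[/orP[]|] /eqP ->; rewrite cards2 ?xy ?yz ?zw.
  move=> C; rewrite t1 => /eqP/cards1P[e ->] hC; exfalso.
  have := hC [set x; y]; have := hC [set z; w].
  rewrite !inE !eqxx !orbT !sub1set !inE => /(_ isT) h1 /(_ isT) h2.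
  by case/orP: h1 => /eqP e1; case/orP: h2 => /eqP e2; move: xz xw yz yw;
     rewrite -e1 -e2 eqxx.
have u' : uniq [:: a; c; b; d].
  move: u; rewrite /= !inE !negb_or => /and4P[/and3P[-> -> ->] /andP[bc ->] -> _].
  by rewrite eq_sym bc.
split; [| | |exact: tauB|exact: tauB].
- by apply/subsetP => F; rewrite !inE => /orP[/orP[]|] /andP[].
- by apply/subsetP => F; rewrite !inE => /orP[/orP[]|] /andP[].
move=> F G; rewrite !inE !subUset !sub1set t1 => hF hG.
suff [x xF xG] : exists2 x, x \in F & x \in G by apply/card_gt0P; exists x; rewrite inE xF.
by case/orP: hF => [/orP[]|] /andP[_ /andP[? ?]];
   case/orP: hG => [/orP[]|] /andP[_ /andP[? ?]]; eauto.
Qed.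

End Admissibility.

(** * Counting next covers *)

Section NextCovers.
Variables (T : finType) (t k : nat) (GG : {set {set T}}).
Local Notation NC := (next_covers t GG).
Implicit Types (C F R S W : {set T}) (x i : T).

Lemma next_coverP C : reflect (#|C| = t.+1 /\ t_cover t GG C) (C \in NC).
Proof. by rewrite inE; apply: (iffP andP) => -[/eqP]. Qed.

Definition exchanges R i : {set T} := [set x | (x \notin R) && (x |: R :\ i \in NC)].

(** A (t+1)-set meeting R in t points is R or arises from it by one exchange. *)
Lemma card_next_covers_exchanges R : #|R| = t.+1 ->
  (forall C, C \in NC -> t <= #|C :&: R|) ->
  #|NC| <= (R \in NC) + \sum_(i in R) #|exchanges R i|.
Proof.
move=> cR near; rewrite (cardsD1 R NC) leq_add2l.
have : #|NC :\ R| <= #|\bigcup_(i in R) [set x |: R :\ i | x in exchanges R i]|.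
  apply/subset_leq_card/subsetP => C; rewrite !inE => /andP[neq hC].
  have /next_coverP[cC _] : C \in NC by rewrite inE.
  have nearC : t <= #|C :&: R| by apply: near; rewrite inE.
  have sub : C :&: R \proper R.
    rewrite properE subsetIr; apply/negP => RC; move/negP: neq; apply.
    rewrite eq_sym eqEcard cC cR leqnn andbT.
    by apply: subset_trans RC (subsetIl _ _).
  have cCR : #|C :&: R| = t by have := proper_card sub; rewrite cR; lia.
  have [i iR iC] := subsetPn (proper_subn sub).
  have eR : R :\ i = C :&: R.
    apply/eqP; rewrite eq_sym eqEcard cards_setD1 // cR cCR leqnn andbT.
    apply/subsetP => y yCR; rewrite !inE; apply/andP; split; last first.
      by move: yCR; rewrite inE => /andP[].
    by apply: contraNneq iC => <-.
  have [x xCR] : exists x, x \in C :\: R.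
    by apply/set0Pn; rewrite -cards_eq0; have := cardsID R C; lia.
  have [xC xR] : x \in C /\ x \notin R by move: xCR; rewrite inE => /andP[].
  have eC : x |: R :\ i = C.
    apply/eqP; rewrite eqEcard subUset sub1set xC eR subsetIl /=.
    by rewrite cC cardsU1 cCR inE (negPf xR) andbF.
  apply/bigcupP; exists i => //; apply/imsetP; exists x => //.
  by rewrite inE xR eC inE.
move=> /leq_trans; apply.
apply: (@leq_trans (\sum_(i in R) #|[set x |: R :\ i | x in exchanges R i]|)).
  elim/big_rec2: _ => [|i y1 y2 _ h]; first by rewrite cards0.
  by have := cardsUI [set x |: R :\ i | x in exchanges R i] y2; lia.
by apply: leq_sum => i _; apply: leq_imset_card.
Qed.

Hypotheses (t0 : 0 < t) (tk : t < k).
Hypotheses (GGk : GG \subset ksubsets [set: T] k) (tauG : t + 1 <= tau t GG).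

Lemma not_cover_small S : #|S| = t -> ~~ t_cover t GG S.
Proof. by move=> cS; apply/negP => /tau_le; lia. Qed.

Lemma next_covers_above W : #|W| = t ->
  exists2 A : {set T}, #|A| = k - t + 1 /\ [disjoint A & W] &
    forall C, C \in NC -> W \subset C -> exists2 x, x \in A & C = x |: W.
Proof.
move=> cW; have [A [cA dA] hA] := branching (ltnW tk) GGk (not_cover_small cW).
exists A => // C /next_coverP[cC hC] WC; have [x xA xC] := hA _ WC hC.
exists x => //; apply/eqP; rewrite eq_sym eqEcard xC cC.
by rewrite cardsU1 (disjointFr dA xA) cW add1n leqnn.
Qed.

Lemma card_next_covers_above W : #|W| = t ->
  #|[set C in NC | W \subset C]| <= k - t + 1.
Proof.
move=> cW; have [A [<- _] hA] := next_covers_above cW.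
apply: (@leq_trans #|[set x |: W | x in A]|); last exact: leq_imset_card.
apply/subset_leq_card/subsetP => C; rewrite inE => /andP[hC WC].
by have [x xA ->] := hA _ hC WC; apply/imsetP; exists x.
Qed.

(** A cover above R minus i contains one of k - t + 1 candidates; when R is itself
    a cover, one of these candidates is i. *)
Lemma card_exchanges R i : #|R| = t.+1 -> i \in R ->
  #|exchanges R i| + (R \in NC) <= k - t + 1.
Proof.
move=> cR iR.
have cRi : #|R :\ i| = t by rewrite cards_setD1 // cR.
have [A [<- dA] hA] := next_covers_above cRi.
have sub : exchanges R i \subset A.
  apply/subsetP => x; rewrite inE => /andP[xR hx].
  have [|y yA e] := hA _ hx; first exact: subsetU1.
  have : x \in y |: R :\ i by rewrite -e setU11.
  by rewrite !inE (negPf xR) andbF orbF => /eqP ->.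
have [hR|_] := boolP (R \in NC); last by rewrite addn0; apply: subset_leq_card.
have [|y yA e] := hA _ hR; first exact: subsetDl.
have iy : i = y.
  by have := iR; rewrite {1}e !inE eqxx /= orbF => /eqP.
rewrite addn1 (cardsD1 i A) iy yA add1n ltnS -iy; apply: subset_leq_card.
apply/subsetP => x hx; rewrite in_setD1 (subsetP sub) // andbT.
by apply: contraTneq hx => ->; rewrite inE iR.
Qed.

(** Some F in GG meets R in fewer than t points. A single exchange can repair this
    only if F misses exactly two points of R and one of these is exchanged. *)
Lemma card_next_covers_near_noncover R : #|R| = t.+1 ->
  (forall C, C \in NC -> t <= #|C :&: R|) -> R \notin NC -> #|NC| <= 2 * (k - t + 1).
Proof.
move=> cR near nR.
have : ~~ t_cover t GG R by apply: contra nR => hR; apply/next_coverP.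
rewrite negb_forall_in => /exists_inP[F GG_F]; rewrite -ltnNge => hF.
have exch i x : i \in R -> x \in exchanges R i -> i \notin F /\ #|R :&: F| = t.-1.
  move=> iR; rewrite inE => /andP[xR /next_coverP[_ /t_coverP/(_ _ GG_F)]].
  have : (x |: R :\ i) :&: F \subset x |: (R :&: F) :\ i.
    by apply/subsetP => y; rewrite !inE; case: (y == x) => //= /andP[/andP[-> ->] ->].
  move/subset_leq_card; rewrite cardsU1 => h1 h2.
  have := cardsD1 i (R :&: F); rewrite in_setI iR /= => h3.
  move: h1 h2 h3 hF; case: (i \in F); case: (x \notin _) => /=; lia.
apply: leq_trans (card_next_covers_exchanges cR near) _; rewrite (negPf nR) add0n.
rewrite (bigID (mem F)) /= big1 => [|i /andP[iR iF]]; last first.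
  apply/eqP; rewrite cards_eq0; apply/eqP/setP => x; rewrite [RHS]inE.
  by apply/negP => hx; have [] := exch i x iR hx; rewrite iF.
rewrite add0n.
have [/exists_inP[i iR /set0Pn[x hx]]|] := boolP [exists i in R, exchanges R i != set0].
  have [_ cRF] := exch i x iR hx.
  apply: (@leq_trans (\sum_(i in R :\: F) (k - t + 1))); last first.
    rewrite sum_nat_const leq_mul2r; apply/orP; right.
    by have := cardsID F R; lia.
  rewrite (eq_bigl (fun j => j \in R :\: F)); last by move=> j; rewrite !inE andbC.
  apply: leq_sum => j; rewrite inE => /andP[_ jR].
  by have := card_exchanges cR jR; lia.
rewrite negb_exists_in => /forall_inP h; rewrite big1 // => i /andP[iR _].
by apply/eqP; rewrite cards_eq0; have := h _ iR; rewrite negbK.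
Qed.

Lemma card_next_covers_near_cover R : R \in NC ->
  (forall C, C \in NC -> t <= #|C :&: R|) -> #|NC| <= (t + 1) * (k - t) + 1.
Proof.
move=> hR near; have /next_coverP[cR _] := hR.
apply: leq_trans (card_next_covers_exchanges cR near) _; rewrite hR addnC leq_add2r.
apply: (@leq_trans (\sum_(i in R) (k - t))).
  by apply: leq_sum => i iR; have := card_exchanges cR iR; rewrite hR; lia.
by rewrite sum_nat_const cR addn1.
Qed.

Lemma card_next_covers_near R : #|R| = t.+1 ->
  (forall C, C \in NC -> t <= #|C :&: R|) -> #|NC| <= (t + 1) * (k - t + 1).
Proof.
move=> cR near; have [hR|nR] := boolP (R \in NC).
  by have := card_next_covers_near_cover hR near; nia.
by have := card_next_covers_near_noncover cR near nR; nia.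
Qed.

End NextCovers.

(** * Extremal pairs *)

(** The main part of the lower bound on the size of the ground set, against which
    the corrections in [leading_comparison] are measured. *)
Definition scale k1 k2 t := (t + 1) ^ 2 * (k1 + k2) ^ 2 * (k1 - t + 1) * (k2 - t + 1).

Definition large_ground n k1 k2 t := scale k1 k2 t + k1 + k2 - t <= n.

Lemma scale_sym k1 k2 t : scale k1 k2 t = scale k2 k1 t.
Proof. by rewrite /scale (addnC k2 k1) [RHS]mulnAC. Qed.

Definition extremal (T : finType) k1 k2 t (F1 F2 : {set {set T}}) : Prop :=
  [/\ [/\ 0 < t, t < k1, t < k2 & large_ground #|T| k1 k2 t],
      nontrivial_pair k1 k2 t F1 F2 &
      forall G1 G2 : {set {set T}}, nontrivial_pair k1 k2 t G1 G2 ->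
        #|G1| * #|G2| <= #|F1| * #|F2|].

Lemma extremal_sym (T : finType) k1 k2 t (F1 F2 : {set {set T}}) :
  extremal k1 k2 t F1 F2 -> extremal k2 k1 t F2 F1.
Proof.
case=> -[t0 tk1 tk2 hn] /nontrivial_pair_sym hF hmax; split=> //.
  split=> //; move: hn; rewrite /large_ground scale_sym; lia.
by move=> G1 G2 /nontrivial_pair_sym/hmax; rewrite mulnC (mulnC #|F1|).
Qed.

Section Extremal.
Variables (T : finType) (k1 k2 t : nat) (F1 F2 : {set {set T}}).
Hypothesis ext : extremal k1 k2 t F1 F2.
Implicit Types (C F G R S W X Y Z : {set T}).

Let t0 : 0 < t. Proof. by case: ext => -[]. Qed.
Let tk1 : t < k1. Proof. by case: ext => -[]. Qed.
Let tk2 : t < k2. Proof. by case: ext => -[]. Qed.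
Let hF : nontrivial_pair k1 k2 t F1 F2. Proof. by case: ext. Qed.
Let tau1 : t + 1 <= tau t F1. Proof. by case: hF. Qed.

Lemma extremal_room : k1 + k2 <= #|T| /\ 2 * t + 2 <= #|T| /\ k1 + t < #|T| /\ k2 + t < #|T|.
Proof.
case: ext => -[_ _ _ hn] _ _; move: hn; rewrite /large_ground => hn.
have : k1 + k2 <= scale k1 k2 t.
  apply: (@leq_trans ((k1 + k2) ^ 2)); first by rewrite expnS expn1 leq_pmulr //; lia.
  by rewrite /scale -2!mulnA mulnCA leq_pmulr // !muln_gt0 !addn1.
lia.
Qed.

Lemma extremal_cover F : F \in F1 -> t_cover t F2 F.
Proof. by case: hF => _ _ cr _ _ FF1; apply/t_coverP => G; apply: cr. Qed.

Lemma extremal_nonempty : exists F, F \in F1.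
Proof.
have [|F F1F _] := @not_cover_of_tau _ t F1 set0; first by rewrite cards0; lia.
by exists F.
Qed.

End Extremal.

(** * Covering numbers of an extremal pair *)

Lemma above_decay n k t j : k < n -> t + j < k ->
  above n k (t.+1 + j) * (n - t.+1) ^ j <= above n k t.+1 * (k - t.+1) ^ j.
Proof.
move=> kn; elim: j => [|j IH] tjk; first by rewrite addn0 !expn0 !muln1.
have {}IH := IH ltac:(lia).
have step := aboveS (t.+1 + j) (ltnW kn).
have mono : (k - (t.+1 + j)) * (n - t.+1) <= (k - t.+1) * (n - (t.+1 + j)).
  have [u hu] : exists u, k = t.+1 + j + u by exists (k - (t.+1 + j)); lia.
  have [v hv] : exists v, n = t.+1 + j + u + v by exists (n - (t.+1 + j + u)); lia.
  have -> : k - (t.+1 + j) = u by lia.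
  have -> : n - t.+1 = j + u + v by lia.
  have -> : k - t.+1 = j + u by lia.
  have -> : n - (t.+1 + j) = u + v by lia.
  nia.
have pos : 0 < n - (t.+1 + j) by lia.
have {step mono} : above n k (t.+1 + j.+1) * (n - t.+1) <= above n k (t.+1 + j) * (k - t.+1).
  rewrite -(leq_pmul2r pos) addnS mulnAC step -!mulnA leq_mul2l mono orbT //.
move=> step; rewrite expnS mulnA.
apply: (@leq_trans (above n k (t.+1 + j) * (k - t.+1) * (n - t.+1) ^ j)).
  by rewrite leq_mul2r step orbT.
by rewrite mulnAC expnSr mulnA leq_mul2r IH orbT.
Qed.

Lemma four_mul_le a b c : a + b <= c -> 4 * (a * b) <= c ^ 2.
Proof. by move=> h; apply: leq_trans (nat_AGM2 a b).1 _; rewrite leq_sqr. Qed.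

Lemma leq_exp2l_base a b j : a <= b -> a ^ j <= b ^ j.
Proof. by case: j => // j ab; rewrite leq_exp2r. Qed.

Lemma bin_next_le t j : 'C(t.+1 + j, t) <= t.+1 ^ j.+1.
Proof.
elim: j => [|j IH]; first by rewrite addn0 binSn expn1.
have := mul_bin_down (t.+1 + j.+1) t; rewrite addnS /=.
have -> : (t.+1 + j).+1 - t = j.+2 by lia.
move=> e; rewrite -(leq_pmul2l (isT : 0 < j.+2)) -e expnS.
have : (t.+1 + j).+1 * 'C(t.+1 + j, t) <= (t.+1 + j).+1 * t.+1 ^ j.+1 by rewrite leq_mul2l IH orbT.
move/leq_trans; apply; rewrite mulnA leq_mul2r; apply/orP; right; nia.
Qed.

(** With R = a * x1 * x2 and J = j1 + j2, multiplying the first two bounds gives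
    u1 * u2 * m ^ J <= a * R * N1 * N2 * R ^ J. As m is much larger than R, any
    J > 0 contradicts the lower bound on u1 * u2. *)
Lemma tau_product_bound a x1 x2 K m j1 j2 u1 u2 N1 N2 :
  u1 * m ^ j2 <= a ^ j1.+1 * x2 ^ j2.+1 * (N1 * x1 ^ j2) ->
  u2 * m ^ j1 <= a ^ j2.+1 * x1 ^ j1.+1 * (N2 * x2 ^ j1) ->
  (a * N1) * (a * N2) <= u1 * u2 -> 0 < N1 -> 0 < N2 ->
  0 < a -> 0 < x1 -> 0 < x2 -> x1 * x2 <= K ->
  a ^ 2 * (K * (x1 * x2)) < m -> j1 + j2 = 0.
Proof.
move=> b1 b2 low N10 N20 a0 x10 x20 xK am.
apply/eqP; rewrite -leqn0 leqNgt; apply/negP => J0.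
have [J eJ] : exists J, j1 + j2 = J.+1 by exists (j1 + j2).-1; lia.
pose R := a * (x1 * x2).
have R0 : 0 < R by rewrite /R !muln_gt0 a0 x10 x20.
have RaK : R <= a * K by rewrite leq_mul2l xK orbT.
have aKR : a * K * R < m by move: am; rewrite /R expnS expn1; lia.
have RR : R * R < m by apply: leq_ltn_trans aKR; rewrite leq_mul2r RaK orbT.
have Rm : R <= m by apply: leq_trans (ltnW RR); rewrite leq_pmulr.
have ub : u1 * u2 * m ^ J.+1 <= (a * R) * (N1 * N2) * R ^ J.+1.
  have := leq_mul b1 b2; rewrite mulnACA -expnD (addnC j2) eJ => /leq_trans; apply.
  rewrite -eJ /R !expnMn !expnD !expnS; apply: eq_leq; lia.
have : (a * N1) * (a * N2) * (m * R ^ J) <= (a * R) * (N1 * N2) * R ^ J.+1.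
  apply: leq_trans ub; apply: leq_mul => //; rewrite expnS leq_mul2l.
  by rewrite leq_exp2l_base // orbT.
have -> : a * N1 * (a * N2) * (m * R ^ J) = (a * N1 * N2 * R ^ J) * (a * m) by lia.
have -> : a * R * (N1 * N2) * R ^ J.+1 = (a * N1 * N2 * R ^ J) * (R * R) by rewrite expnS; lia.
rewrite leq_pmul2l ?muln_gt0 ?a0 ?N10 ?N20 ?expn_gt0 ?R0 // => h.
have : m <= a * m by rewrite leq_pmull.
lia.
Qed.

Lemma tau_size_bound (T : finType) (k1 k2 t : nat) (F1 F2 : {set {set T}}) j1 j2 :
  extremal k1 k2 t F1 F2 -> tau t F1 = t.+1 + j1 -> tau t F2 = t.+1 + j2 ->
  #|F1| * (#|T| - t.+1) ^ j2 <= (t + 1) ^ j1.+1 * (k2 - t + 1) ^ j2.+1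
    * (above #|T| k1 t.+1 * (k1 - t + 1) ^ j2).
Proof.
move=> ext e1 e2; have [r1 [r2 [r3 r4]]] := extremal_room ext.
have [F F1F] := extremal_nonempty ext.
have [G F2G] := extremal_nonempty (extremal_sym ext).
have [C hC cC] := tau_attained (extremal_cover (extremal_sym ext) F2G).
have cov2 := extremal_cover ext.
have [[t0 tk1 tk2 _] [F1k F2k _ _ _] _] := ext.
have j2k : t + j2 < k1.
  have : tau t F2 <= #|F| by apply/tau_le/cov2.
  by have := subsetP F1k _ F1F; rewrite in_ksets => /eqP ->; lia.
have kT1 : k1 <= #|T| by lia.
have kT2 : k1 < #|T| by lia.
have tt2 : t <= tau t F2 by lia.
have ej : t.+1 + j2 - t = j2.+1 by lia.
have le1 : k1 - t.+1 <= k1 - t + 1 by lia.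
have := family_bound (ltnW tk2) kT1 F1k F2k cov2 hC tt2; rewrite cC e1 e2 ej => ub.
have := above_decay kT2 j2k => dec.
have hb := bin_next_le t j1; have hz := leq_exp2l_base j2 le1; rewrite addn1 in hb *.
apply: leq_trans (leq_mul ub (leqnn _)) _.
rewrite -!mulnA leq_mul // leq_mul //.
by apply: leq_trans dec _; rewrite leq_mul2l hz orbT.
Qed.

Section Extremal.
Variables (T : finType) (k1 k2 t : nat) (F1 F2 : {set {set T}}).
Hypothesis ext : extremal k1 k2 t F1 F2.
Implicit Types (C F G R S W X Y Z : {set T}).

Let t0 : 0 < t. Proof. by case: ext => -[]. Qed.
Let tk1 : t < k1. Proof. by case: ext => -[]. Qed.
Let tk2 : t < k2. Proof. by case: ext => -[]. Qed.
Let hF : nontrivial_pair k1 k2 t F1 F2. Proof. by case: ext. Qed.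
Let F2k : F2 \subset ksubsets [set: T] k2. Proof. by case: hF. Qed.
Let tau2 : t + 1 <= tau t F2. Proof. by case: hF. Qed.
Let hmax : forall G1 G2 : {set {set T}}, nontrivial_pair k1 k2 t G1 G2 ->
        #|G1| * #|G2| <= #|F1| * #|F2|. Proof. by case: ext. Qed.
Let F1k : F1 \subset ksubsets [set: T] k1. Proof. by case: hF. Qed.
Let tau1 : t + 1 <= tau t F1. Proof. by case: hF. Qed.

(** Adding F to F1 keeps the pair admissible, since covering numbers only grow. *)
Lemma extremal_closed F : #|F| = k1 -> t_cover t F2 F -> F \in F1.
Proof.
move=> cF hFc; have [G hG] := extremal_nonempty (extremal_sym ext).
have np : nontrivial_pair k1 k2 t (F |: F1) F2.
  case: hF => _ _ cr _ _; split=> //.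
  - by rewrite subUset sub1set in_ksets cF eqxx.
  - move=> F' G' /setU1P[->|F1F'] G'F2; last exact: cr.
    by move/t_coverP: hFc; apply.
  have [|D hD <-] := @tau_attained _ t (F |: F1) [set: T].
    apply/t_coverP => F'; rewrite setTI => /setU1P[->|/(subsetP F1k)]; first lia.
    by rewrite in_ksets => /eqP; lia.
  apply: leq_trans tau1 (tau_le _); apply: t_coverS hD; exact: subsetUr.
have := hmax np; rewrite leq_pmul2r; last by apply/card_gt0P; exists G.
by rewrite cardsU1; case: (F \in F1) => //=; lia.
Qed.

(** A k1-set above R that avoids S outside R is a cover of F2, hence a member of
    F1, and S covers F1. *)
Lemma extremal_cross_covers S R : S \in next_covers t F1 -> R \in next_covers t F2 ->
  t <= #|S :&: R|.
Proof.
move=> /next_coverP[cS /t_coverP hS] /next_coverP[cR hR].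
have [r1 [r2 [r3 r4]]] := extremal_room ext.
have [||F cF [RF FS]] := @extend_avoiding T k1 R S; [by rewrite cR|by rewrite cS; lia|].
have /hS h : F \in F1 by apply: extremal_closed cF (cover_above RF hR).
by apply: leq_trans h (subset_leq_card _); rewrite subsetI subsetIl setIC.
Qed.

Let m := #|T| - t.+1.
Let mD : scale k1 k2 t < m.
Proof.
case: ext => -[_ _ _ hn] _ _; move: hn; have := extremal_room ext; rewrite /large_ground /m; lia.
Qed.

Let lead_pos k : t < k -> k <= #|T| -> 0 < above #|T| k t.+1.
Proof. by move=> tk kT; apply: above_gt0. Qed.

Let decay k : k <= #|T| -> above #|T| k t.+2 * m = above #|T| k t.+1 * (k - t.+1).
Proof. by move=> kT; rewrite /m aboveS. Qed.

(** One star out of the t + 2 pays for all the overlaps. *)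
Lemma genA_large (Z : {set T}) k : #|Z| = t + 2 -> t < k -> k <= k1 + k2 -> k <= #|T| ->
  (t + 1) * above #|T| k t.+1 <= #|genA k t Z|.
Proof.
move=> cZ tk kK kT; have low := genA_lower cZ kT.
have err : (t + 2) * (t + 1) * above #|T| k t.+2 <= above #|T| k t.+1.
  have m0 : 0 < m by lia.
  rewrite -(leq_pmul2r m0) -mulnA decay // mulnCA leq_mul2l; apply/orP; right.
  apply: leq_trans (ltnW mD).
  apply: (@leq_trans (((t + 1) * (k1 + k2)) ^ 2)).
    rewrite expnS expn1; apply: leq_mul; first by rewrite mulnC leq_mul2l; lia.
    by apply: (@leq_trans (k1 + k2)); [lia | rewrite leq_pmull // addn1].
  by rewrite expnMn /scale -mulnA leq_pmulr // muln_gt0 !addn1.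
lia.
Qed.

(** Covering numbers t+1+j1 and t+1+j2 cost a factor of order n ^ (j1 + j2) in the
    product, which would fall below that of the pair built on a (t+2)-set. The
    first choice for either family is made among the t-subsets of a smallest
    cover of that family and costs a power of t + 1 only; this is why it pays to
    bound the product instead of each factor. *)
Lemma extremal_covers : (exists S, S \in next_covers t F1) /\ (exists R, R \in next_covers t F2).
Proof.
have [r1 [r2 [r3 r4]]] := extremal_room ext.
have [kT1 kT2] : k1 <= #|T| /\ k2 <= #|T| by lia.
have [x10 x20] : 0 < k1 - t + 1 /\ 0 < k2 - t + 1 by lia.
have xK : (k1 - t + 1) * (k2 - t + 1) <= (k1 + k2) ^ 2.
  have : k1 - t + 1 + (k2 - t + 1) <= k1 + k2 by lia.
  by move/four_mul_le; apply: leq_trans; rewrite leq_pmull.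
have [j1 ej1] : exists j, tau t F1 = t.+1 + j by exists (tau t F1 - t.+1); lia.
have [j2 ej2] : exists j, tau t F2 = t.+1 + j by exists (tau t F2 - t.+1); lia.
have [G F2G] := extremal_nonempty (extremal_sym ext).
have [F F1F] := extremal_nonempty ext.
have [C1 hC1 cC1] := tau_attained (extremal_cover (extremal_sym ext) F2G).
have [C2 hC2 cC2] := tau_attained (extremal_cover ext F1F).
suff J0 : j1 + j2 = 0.
  by split; [exists C1 | exists C2]; apply/next_coverP; split=> //; lia.
have [|Z _ cZ] := @subset_of_card _ [set: T] (t + 2); first by rewrite cardsT; lia.
have np := genA_pair cZ t0 tk1 tk2 (ltnW r3) (ltnW r4).
have a1 := genA_large cZ tk1 (leq_addr k2 k1) kT1.
have a2 := genA_large cZ tk2 (leq_addl k1 k2) kT2.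
have low := leq_trans (leq_mul a1 a2) (hmax np).
have b1 := tau_size_bound ext ej1 ej2.
have b2 := tau_size_bound (extremal_sym ext) ej2 ej1.
apply: (tau_product_bound b1 b2 low (lead_pos tk1 kT1) (lead_pos tk2 kT2) _ x10 x20 xK).
  by rewrite addn1.
by move: mD; rewrite /scale -2!mulnA.
Qed.

End Extremal.

(** * Lower bounds on the numbers of next covers *)

Lemma leq_scale k1 k2 t x1 x2 y z : x1 <= k1 - t + 1 -> x2 <= k2 - t + 1 ->
  y <= (t + 1) ^ 2 -> z <= (k1 + k2) ^ 2 -> y * z * x1 * x2 <= scale k1 k2 t.
Proof. by move=> ? ? ? ?; rewrite /scale !leq_mul. Qed.

Section Extremal.
Variables (T : finType) (k1 k2 t : nat) (F1 F2 : {set {set T}}).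
Hypothesis ext : extremal k1 k2 t F1 F2.
Implicit Types (C F G R S W X Y Z : {set T}).

Let t0 : 0 < t. Proof. by case: ext => -[]. Qed.
Let tk2 : t < k2. Proof. by case: ext => -[]. Qed.
Let F2k : F2 \subset ksubsets [set: T] k2. Proof. by case: ext => _ []. Qed.
Let tau2 : t + 1 <= tau t F2. Proof. by case: ext => _ []. Qed.
Let F1k : F1 \subset ksubsets [set: T] k1. Proof. by case: ext => _ []. Qed.

Lemma card_second_covers : 0 < #|next_covers t F2| <= (t + 1) * (k2 - t + 1).
Proof.
have [[S hS] [R hR]] := extremal_covers ext.
apply/andP; split; first by apply/card_gt0P; exists R.
have /next_coverP[cS _] := hS.
apply: (card_next_covers_near t0 tk2 F2k tau2 cS) => C hC.
by rewrite setIC; apply: (extremal_cross_covers ext).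
Qed.

Lemma first_size_bound : #|F1| <= #|next_covers t F2| * above #|T| k1 t.+1
   + (t + 1) * (k2 - t + 1) ^ 2 * above #|T| k1 t.+2.
Proof.
have [[S /next_coverP[cS hS]] _] := extremal_covers ext.
have [_ [_ [r3 _]]] := extremal_room ext.
have k1T : k1 <= #|T| by lia.
have tau2' : t < tau t F2 by rewrite -addn1.
have := refined_bound (ltnW tk2) k1T F1k F2k (extremal_cover ext) hS cS tau2'.
by rewrite (mulnA t.+1) (addn1 t).
Qed.

End Extremal.

Section Compare.
Variables (T : finType) (k1 k2 t : nat) (F1 F2 : {set {set T}}).
Hypothesis ext : extremal k1 k2 t F1 F2.
Implicit Types (C F R S W X Y Z : {set T}) (G : {set {set T}}).
Local Notation p := #|next_covers t F1|.
Local Notation q := #|next_covers t F2|.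

Let t0 : 0 < t. Proof. by case: ext => -[]. Qed.
Let tk1 : t < k1. Proof. by case: ext => -[]. Qed.
Let tk2 : t < k2. Proof. by case: ext => -[]. Qed.

Lemma extremal_compare (G1 G2 : {set {set T}}) e1 e2 E1 E2 : nontrivial_pair k1 k2 t G1 G2 ->
  e1 * above #|T| k1 t.+1 <= #|G1| + E1 * above #|T| k1 t.+2 ->
  e2 * above #|T| k2 t.+1 <= #|G2| + E2 * above #|T| k2 t.+2 ->
  3 * (e1 * (E2 * (k2 - t.+1)) + e2 * (E1 * (k1 - t.+1))) <= scale k1 k2 t ->
  e1 * e2 <= p * q.
Proof.
move=> np low1 low2 small.
have [_ _ hmax] := ext.
have [r1 [r2 [r3 r4]]] := extremal_room ext.
have [k1T k2T] : k1 <= #|T| /\ k2 <= #|T| by lia.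
have /andP[q0 qb] := card_second_covers ext.
have /andP[p0 pb] := card_second_covers (extremal_sym ext).
have b1 := first_size_bound ext; have b2 := first_size_bound (extremal_sym ext).
have mD : scale k1 k2 t < #|T| - t.+1.
  by case: ext => -[_ _ _]; rewrite /large_ground; lia.
have xd1 : 4 * ((k2 - t + 1) * (k1 - t.+1)) <= (k1 + k2) ^ 2 by apply: four_mul_le; lia.
have xd2 : 4 * ((k1 - t + 1) * (k2 - t.+1)) <= (k1 + k2) ^ 2 by apply: four_mul_le; lia.
apply: (leading_comparison (above_gt0 tk1 k1T) (above_gt0 tk2 k2T) (aboveS _ k1T)
  (aboveS _ k2T) p0 q0 b1 b2 low1 low2 (hmax _ _ np) _ _ small mD).
  apply: leq_trans (leq_scale (leqnn _) (leqnn _) (leqnn _) xd1).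
  apply: (@leq_trans (4 * ((t + 1) * (k1 - t + 1)
                       * ((t + 1) * (k2 - t + 1) ^ 2 * (k1 - t.+1))))).
    by rewrite leq_mul2l /= leq_mul2r pb orbT.
  rewrite !expnS !expn0; apply: eq_leq; lia.
apply: leq_trans (leq_scale (leqnn _) (leqnn _) (leqnn _) xd2).
apply: (@leq_trans (4 * ((t + 1) * (k2 - t + 1)
                     * ((t + 1) * (k1 - t + 1) ^ 2 * (k2 - t.+1))))).
  by rewrite leq_mul2l /= leq_mul2r qb orbT.
rewrite !expnS !expn0; apply: eq_leq; lia.
Qed.

Lemma covers_ge_A : (t + 2) * (t + 2) <= p * q.
Proof.
have [r1 [r2 [r3 r4]]] := extremal_room ext.
have [k1T k2T] : k1 <= #|T| /\ k2 <= #|T| by lia.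
have [|Z _ cZ] := @subset_of_card _ [set: T] (t + 2); first by rewrite cardsT; lia.
have np := genA_pair cZ t0 tk1 tk2 (ltnW r3) (ltnW r4).
apply: (extremal_compare np (genA_lower cZ k1T) (genA_lower cZ k2T)).
have [s1 es1] : exists s, k1 = t + 1 + s by exists (k1 - (t + 1)); lia.
have [s2 es2] : exists s, k2 = t + 1 + s by exists (k2 - (t + 1)); lia.
have -> : k1 - t.+1 = s1 by lia.
have -> : k2 - t.+1 = s2 by lia.
apply: (@leq_trans ((t + 1) ^ 2 * (2 * (t + 1)) ^ 2 * (s1 + 2) * (s2 + 2))); last first.
  by apply: leq_scale; rewrite ?leq_sqr //; lia.
have s12 : s1 + s2 <= (s1 + 2) * (s2 + 2) by nia.
have tt : 3 * (t + 2) ^ 2 <= (t + 1) * (2 * (t + 1)) ^ 2.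
  have [u ->] : exists u, t = u + 1 by exists t.-1; lia.
  by rewrite !expnS !expn0; nia.
have -> : 3 * ((t + 2) * ((t + 2) * (t + 1) * s2) + (t + 2) * ((t + 2) * (t + 1) * s1))
   = (t + 1) * (3 * (t + 2) ^ 2) * (s1 + s2) by rewrite !expnS !expn0; lia.
rewrite -[X in _ <= X]mulnA; apply: leq_mul => //.
by rewrite (expnS (t + 1) 1) expn1 -mulnA leq_mul2l tt orbT.
Qed.

Lemma flag_exists r1 r2 r3 : r3 <= r2 -> r1 + r2 <= #|T| ->
  exists W X Y, [/\ #|W| = r1, #|X| = r2, #|Y| = r3, [disjoint W & X] & Y \subset X].
Proof.
move=> r32 rT.
have [|W _ cW] := @subset_of_card _ [set: T] r1; first by rewrite cardsT; lia.
have [|X sX cX] := @subset_of_card _ (~: W) r2; first by have := cardsC W; lia.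
have [|Y sY cY] := @subset_of_card _ X r3; first by rewrite cX.
by exists W, X, Y; split=> //; rewrite disjoint_sym disjoints_subset.
Qed.

Lemma covers_ge_H : k2 <= k1 -> (k2 - t + 1) * (k1 - t + 1) <= p * q.
Proof.
move=> k21.
have [r1 [r2 [r3 r4]]] := extremal_room ext.
have [k1T k2T] : k1 <= #|T| /\ k2 <= #|T| by lia.
have [||W [X [Y [cW cX cY dX YX]]]] := @flag_exists t (k1 - t + 1) (k2 - t + 1); [lia|lia|].
have dY : [disjoint W & Y] := disjointWr YX dX.
have XY : minn t 2 <= #|X :&: Y| by rewrite (setIidPr YX) cY; lia.
have np := genH_pair cW t0 tk1 tk2 (ltnW r3) (ltnW r4) cX cY dX dY XY.
have l1 := genH_lower cW X k1T dY; have l2 := genH_lower cW Y k2T dX.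
rewrite cX in l2; rewrite cY in l1.
apply: (extremal_compare np l1 l2).
have y1 : 4 * ((k1 - t + 1).-1 * (k2 - t.+1)) <= (k1 + k2) ^ 2 by apply: four_mul_le; lia.
have y2 : 4 * ((k2 - t + 1).-1 * (k1 - t.+1)) <= (k1 + k2) ^ 2 by apply: four_mul_le; lia.
apply: (@leq_trans (4 * (k1 + k2) ^ 2 * (k1 - t + 1) * (k2 - t + 1))); last first.
  by apply: leq_scale => //; rewrite (@leq_sqr 2); lia.
rewrite -[X in _ <= X]mulnA [X in _ <= X]mulnC.
apply: leq_trans (leq_mul (leqnn _) (_ : 3 * ((k1 - t + 1).-1 * (k2 - t.+1) +
  (k2 - t + 1).-1 * (k1 - t.+1)) <= _)); last by lia.
by apply: eq_leq; lia.
Qed.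

(** For k2 = t + 1 the second family consists of k1 - t + 1 stars, which are single
    sets, and of t petals: k1 + 1 sets, all of which count. *)
Lemma covers_ge_H_small : k2 = t.+1 -> 2 * (k1 + 1) <= p * q.
Proof.
move=> ek2.
have [r1 [r2 [r3 r4]]] := extremal_room ext.
have [k1T k2T] : k1 <= #|T| /\ k2 <= #|T| by lia.
have [||W [X [Y [cW cX cY dX YX]]]] := @flag_exists t (k1 - t + 1) 2; [lia|lia|].
have dY : [disjoint W & Y] := disjointWr YX dX.
have XY : minn t 2 <= #|X :&: Y| by rewrite (setIidPr YX) cY; lia.
have cY' : #|Y| = k2 - t + 1 by lia.
have np := genH_pair cW t0 tk1 tk2 (ltnW r3) (ltnW r4) cX cY' dX dY XY.
have l1 := genH_lower cW X k1T dY; rewrite cY /= in l1.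
have l2 : (k1 + 1) * above #|T| k2 t.+1 <= #|genH k2 W Y X| + 0 * above #|T| k2 t.+2.
  have := genH_lower_small cW cY dY dX; rewrite cX -ek2 addn0.
  by rewrite /above binn muln1; lia.
apply: (extremal_compare np l1 l2).
have -> : k2 - t.+1 = 0 by lia.
rewrite !muln0 add0n muln1.
apply: (@leq_trans (4 * (k1 + k2) ^ 2 * (k1 - t + 1) * 1)); last first.
  by apply: leq_scale => //; rewrite ?(@leq_sqr 2); lia.
have h : 3 * (k1 + 1) <= 2 * (k1 + k2) ^ 2.
  apply: (@leq_trans (2 * (2 * (k1 + k2)))); first lia.
  by rewrite leq_mul2l /= expnS expn1 leq_mul2r; lia.
have h' : k1 - t.+1 <= k1 - t + 1 by lia.
have := leq_mul h h'; lia.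
Qed.

Lemma covers_ge_C : (t + 1) * (k1 - t) + 1 <= p * q.
Proof.
have [r1 [r2 [r3 r4]]] := extremal_room ext.
have [k1T k2T] : k1 <= #|T| /\ k2 <= #|T| by lia.
have [||S [X [Y [cS cX _ dX _]]]] := @flag_exists (t + 1) (k1 - t) 0; [lia|lia|].
have np := genC_pair cS dX t0 tk1 tk2 (ltnW r3) (ltnW r4) cX.
have l1 : 1 * above #|T| k1 t.+1 <= #|genC1 k1 S X| + 0 * above #|T| k1 t.+2.
  by rewrite mul1n addn0; exact: (genC1_lower X cS k1T).
have l2 := genC2_lower cS dX k2T; rewrite cX in l2.
rewrite -[X in X <= _]mul1n; apply: (extremal_compare np l1 l2).
rewrite !mul1n !muln0 !addn0.
have [s es] : exists s, k1 = t + s by exists (k1 - t); lia.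
have -> : k1 - t = s by lia.
apply: (@leq_trans ((t + 1) ^ 2 * (3 * s) * (s + 1) * (k2 - t + 1))); last first.
  apply: leq_scale => //; first by lia.
  apply: (@leq_trans (3 * (k1 + k2))); first lia.
  by rewrite expnS expn1 leq_mul2r; lia.
apply: (@leq_trans ((t + 1) ^ 2 * (3 * s) * (s + 1) * (k2 - t.+1))); last first.
  by rewrite leq_mul2l; apply/orP; right; lia.
rewrite !mulnA leq_mul2r; apply/orP; right.
by rewrite expnS expn1; nia.
Qed.

End Compare.

(** * Shapes forced by many next covers *)

Section OneFamily.
Variables (T : finType) (t k : nat) (FF : {set {set T}}).
Hypothesis FFk : FF \subset ksubsets [set: T] k.
Local Notation NC := (next_covers t FF).
Implicit Types (C F G R S W X Y Z : {set T}).

Lemma sub_genA Z : 0 < t -> (forall z, z \in Z -> Z :\ z \in NC) -> Z != set0 ->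
  FF \subset genA k t Z.
Proof.
move=> t0 hZ /set0Pn[z0 z0Z]; apply/subsetP => F FF_F.
rewrite inE (subsetP FFk) //= addn1.
have hz z : z \in Z -> t + (z \in F) <= #|F :&: Z|.
  move=> zZ; have /next_coverP[_ /t_coverP/(_ _ FF_F)] := hZ _ zZ.
  rewrite (cardsD1 z (F :&: Z)) inE zZ andbT addnC leq_add2l => h; apply: leq_trans h _.
  apply/subset_leq_card/subsetP => y; rewrite !inE.
  by move=> /andP[/andP[-> ->] ->].
have [z] : exists z, z \in F :&: Z.
  by apply/set0Pn; rewrite -cards_eq0; have := hz _ z0Z; lia.
rewrite inE => /andP[zF zZ]; have := hz _ zZ; rewrite zF; lia.
Qed.

(** F meets W in at most t - 1 points, so it needs every x in X to meet x |: W in t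
    points; this exhausts its k points. *)
Lemma petal_shape W X F : #|W| = t -> #|X| = k - t + 1 -> t < k -> [disjoint W & X] ->
  (forall x, x \in X -> x |: W \in NC) -> F \in FF -> ~~ (W \subset F) ->
  exists2 i, i \in W & F = X :|: W :\ i.
Proof.
move=> cW cX tk dX hX FF_F nWF.
have cF : #|F| = k by apply/eqP; rewrite -in_ksets (subsetP FFk).
have small : #|W :&: F| < t.
  rewrite -cW; apply: proper_card; rewrite properE subsetIl /=.
  by apply: contra nWF => h; apply: subset_trans h (subsetIr _ _).
have hx x : x \in X -> x \in F /\ t <= #|W :&: F| + 1.
  move=> xX; have /next_coverP[_ /t_coverP/(_ _ FF_F) h] := hX _ xX.
  have [xF|nxF] := boolP (x \in F).
    split=> //; apply: leq_trans h _; rewrite addn1.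
    have : (x |: W) :&: F \subset x |: (W :&: F).
      by apply/subsetP => y; rewrite !inE => /andP[/orP[->|->] ->] //; rewrite orbT.
    by move/subset_leq_card/leq_trans; apply; rewrite cardsU1; case: (_ \notin _); lia.
  have : (x |: W) :&: F \subset W :&: F.
    apply/subsetP => y; rewrite !inE => /andP[/orP[/eqP ->|->] yF]; last by rewrite yF.
    by rewrite yF in nxF.
  by move/subset_leq_card; lia.
have [x xX] : exists x, x \in X by apply/set0Pn; rewrite -cards_eq0 cX; lia.
have [_ large] := hx _ xX.
have [i iW iF] := subsetPn nWF.
have t0 : 0 < t by rewrite -cW; apply/card_gt0P; exists i.
exists i => //; apply/esym/eqP; rewrite eqEcard (card_petalH cW t0 tk cX dX iW) cF leqnn andbT.
have sub : W :&: F \subset W :\ i.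
  by apply/subsetP => y; rewrite !inE => /andP[-> yF]; rewrite andbT; apply: contraNneq iF => <-.
have eW : W :&: F = W :\ i.
  by apply/eqP; rewrite eqEcard sub cards_setD1 //= cW; lia.
rewrite subUset -eW subsetIr andbT; apply/subsetP => y /hx[] //.
Qed.

(** F meets S minus i in t - 1 points only, so it contains every x that can be
    exchanged for i; there are as many such points as F has outside S. *)
Lemma exchange_shape S F j i : S \in NC -> t < k -> #|exchanges t FF S i| = k - t ->
  F \in FF -> j \in S -> S :&: F = S :\ j -> i \in S -> i != j ->
  exchanges t FF S i = F :\: S.
Proof.
move=> /next_coverP[cS hS] tk cE FF_F jS eSF iS ij.
have cF : #|F| = k by apply/eqP; rewrite -in_ksets (subsetP FFk).
have cD : #|F :\: S| = k - t.
  by have := cardsID S F; rewrite setIC eSF cards_setD1 // cS cF; lia.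
apply/eqP; rewrite eqEcard cE cD leqnn andbT; apply/subsetP => x.
rewrite !inE => /andP[-> /andP[_ /t_coverP/(_ _ FF_F)]] /=.
apply: contraTT => xF; rewrite -ltnNge.
have sub : (x |: S :\ i) :&: F \subset S :\ j :\ i.
  apply/subsetP => y; rewrite -eSF !inE => /andP[/orP[/eqP ->|/andP[-> ->]] yF].
    by rewrite yF in xF.
  by rewrite yF.
apply: leq_ltn_trans (subset_leq_card sub) _.
rewrite cards_setD1; last by rewrite !inE ij.
by rewrite cards_setD1 // cS; have := cS; rewrite (cardsD1 j S) jS (cardsD1 i) !inE ij iS; lia.
Qed.

End OneFamily.

Section Extremal.
Variables (T : finType) (k1 k2 t : nat) (F1 F2 : {set {set T}}).
Hypothesis ext : extremal k1 k2 t F1 F2.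
Implicit Types (C F G R S W X Y Z : {set T}).

Let t0 : 0 < t. Proof. by case: ext => -[]. Qed.
Let tk1 : t < k1. Proof. by case: ext => -[]. Qed.
Let tk2 : t < k2. Proof. by case: ext => -[]. Qed.
Let F2k : F2 \subset ksubsets [set: T] k2. Proof. by case: ext => _ []. Qed.
Let F1k : F1 \subset ksubsets [set: T] k1. Proof. by case: ext => _ []. Qed.
Let tau1 : t + 1 <= tau t F1. Proof. by case: ext => _ []. Qed.

Lemma extremal_eq (G1 G2 : {set {set T}}) : F1 \subset G1 -> F2 \subset G2 ->
  #|G1| * #|G2| <= #|F1| * #|F2| -> F1 = G1 /\ F2 = G2.
Proof.
move=> s1 s2 le.
have [F hF] := extremal_nonempty ext; have [G hG] := extremal_nonempty (extremal_sym ext).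
have p1 : 0 < #|F1| by apply/card_gt0P; exists F.
have p2 : 0 < #|F2| by apply/card_gt0P; exists G.
have l1 := subset_leq_card s1; have l2 := subset_leq_card s2.
have e1 : #|G1| <= #|F1|.
  rewrite -(leq_pmul2r p2); apply: leq_trans le; by rewrite leq_mul2l l2 orbT.
have e2 : #|G2| <= #|F2|.
  rewrite -(leq_pmul2l p1); apply: leq_trans le; by rewrite leq_mul2r l1 orbT.
by split; apply/eqP; rewrite eqEcard ?s1 ?s2.
Qed.

Lemma extremal_eq_pair (G1 G2 : {set {set T}}) : F1 \subset G1 -> F2 \subset G2 ->
  nontrivial_pair k1 k2 t G1 G2 -> F1 = G1 /\ F2 = G2.
Proof. by move=> s1 s2 np; apply: extremal_eq => //; case: ext => _ _; apply. Qed.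

Lemma extremal_shape_A Z : #|Z| = t + 2 ->
  (forall z, z \in Z -> Z :\ z \in next_covers t F1) ->
  (forall z, z \in Z -> Z :\ z \in next_covers t F2) ->
  F1 = genA k1 t Z /\ F2 = genA k2 t Z.
Proof.
move=> cZ h1 h2; have [_ [_ [r3 r4]]] := extremal_room ext.
have Z0 : Z != set0 by rewrite -cards_eq0 cZ; lia.
by apply: extremal_eq_pair; [exact: sub_genA|exact: sub_genA|apply: genA_pair => //; lia].
Qed.

Lemma extremal_shape_B a b c d : t = 1 -> uniq [:: a; b; c; d] ->
  [set a; b] \in next_covers t F1 -> [set b; c] \in next_covers t F1 ->
  [set c; d] \in next_covers t F1 ->
  [set a; c] \in next_covers t F2 -> [set b; c] \in next_covers t F2 ->
  [set b; d] \in next_covers t F2 ->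
  F1 = genB k1 a c b d /\ F2 = genB k2 a b c d.
Proof.
move=> t1 u /next_coverP[_ /t_coverP h1] /next_coverP[_ /t_coverP h2].
move=> /next_coverP[_ /t_coverP h3] /next_coverP[_ /t_coverP h4].
move=> /next_coverP[_ /t_coverP h5] /next_coverP[_ /t_coverP h6].
have [_ [_ [r3 r4]]] := extremal_room ext.
have meet (x y : T) F : t <= #|[set x; y] :&: F| -> (x \in F) || (y \in F).
  rewrite t1 => /card_gt0P[z]; rewrite !inE => /andP[/orP[] /eqP -> ->] //.
  by rewrite orbT.
apply: extremal_eq_pair; last by apply: genB_pair => //; lia.
  apply/subsetP => F hF; have := subsetP F1k _ hF; rewrite in_ksets => cF.
  rewrite !inE subsetT cF !subUset !sub1set /=.
  by move: (meet _ _ _ (h1 _ hF)) (meet _ _ _ (h2 _ hF)) (meet _ _ _ (h3 _ hF));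
    case: (a \in F); case: (b \in F); case: (c \in F); case: (d \in F).
apply/subsetP => F hF; have := subsetP F2k _ hF; rewrite in_ksets => cF.
rewrite !inE subsetT cF !subUset !sub1set /=.
by move: (meet _ _ _ (h4 _ hF)) (meet _ _ _ (h5 _ hF)) (meet _ _ _ (h6 _ hF));
  case: (a \in F); case: (b \in F); case: (c \in F); case: (d \in F).
Qed.

Lemma not_cover_witness S : #|S| = t -> exists2 F, F \in F1 & #|S :&: F| < t.
Proof. by move=> cS; apply: not_cover_of_tau; rewrite cS; lia. Qed.

End Extremal.

(** The size depends on k, W and Y only, and in particular not on how X and Y
    meet. *)
Lemma genH_card (T : finType) t k (W X Y : {set T}) : #|W| = t -> [disjoint W & X] ->
  #|genH k W X Y| = #|[set F in ksubsets [set: T] k | (W \subset F) && (1 <= #|F :&: Y|)]| + t.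
Proof.
move=> cW dX; rewrite cardsU_disj.
  congr (_ + _); rewrite card_in_imset // => i j iW jW e; apply/eqP/negPn/negP => ij.
  have : i \in X :|: W :\ j by rewrite !inE ij iW orbT.
  by rewrite -e !inE eqxx orbF (disjointFr dX iW).
apply/pred0P => F /=; apply/negP => /andP[]; rewrite inE => /and3P[_ WF _].
case/imsetP => i iW e; have := subsetP WF _ iW.
by rewrite e !inE eqxx orbF (disjointFr dX iW).
Qed.

Section ShapeH.
Variables (T : finType) (k1 k2 t : nat) (F1 F2 : {set {set T}}).
Hypothesis ext : extremal k1 k2 t F1 F2.
Variables (W X Y : {set T}).
Hypotheses (cW : #|W| = t) (cX : #|X| = k1 - t + 1) (cY : #|Y| = k2 - t + 1).
Hypotheses (dX : [disjoint W & X]) (dY : [disjoint W & Y]).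
Hypothesis hX : forall x, x \in X -> x |: W \in next_covers t F1.
Hypothesis hY : forall y, y \in Y -> y |: W \in next_covers t F2.

Lemma petals_meet i j : i \in W -> j \in W ->
  #|(X :|: W :\ i) :&: (Y :|: W :\ j)| <= #|X :&: Y| + #|W :\ i :\ j|.
Proof.
move=> iW jW; rewrite -cardsU_disj; last first.
  rewrite disjoint_sym; apply: (@disjointWl _ _ (mem W)).
    by apply: subset_trans (subsetDl _ _) (subsetDl _ _).
  by apply: disjointWr dX; apply: subsetIl.
apply/subset_leq_card/subsetP => y; rewrite !inE.
case/andP => /orP[yX|/andP[yi yW]] /orP[yY|/andP[yj yW']].
- by rewrite yX yY.
- by rewrite (disjointFr dX yW') in yX.
- by rewrite (disjointFr dY yW) in yY.
- by rewrite yi yj yW orbT.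
Qed.

Lemma sub_genH : F1 \subset genH k1 W X Y.
Proof.
have [[t0 tk1 tk2 _] [F1k F2k cr _ _] _] := ext.
apply/subsetP => F hF; rewrite inE.
have [WF|nWF] := boolP (W \subset F); last first.
  apply/orP; right; have [i iW ->] := petal_shape F1k cW cX tk1 dX hX hF nWF.
  by apply/imsetP; exists i.
apply/orP; left; rewrite inE (subsetP F1k) //= WF /=.
have [G hG small] := not_cover_witness (extremal_sym ext) cW.
have nWG : ~~ (W \subset G).
  by apply/negP => /setIidPl e; move: small; rewrite e cW ltnn.
have [j jW eG] := petal_shape F2k cW cY tk2 dY hY hG nWG.
have := cr _ _ hF hG; rewrite eG.
have : F :&: (Y :|: W :\ j) \subset (F :&: Y) :|: W :\ j.
  by apply/subsetP => y; rewrite !inE => /andP[-> /orP[->|->]]; rewrite ?orbT.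
move/subset_leq_card => h1 h2.
have := (leq_card_setU (F :&: Y) (W :\ j)).1; rewrite cards_setD1 // cW.
by move: h1 h2 t0; clear; lia.
Qed.

End ShapeH.

Section ShapeHC.
Variables (T : finType) (k1 k2 t : nat) (F1 F2 : {set {set T}}).
Hypothesis ext : extremal k1 k2 t F1 F2.
Implicit Types (C F G R S W X Y Z : {set T}).

(** Were X and Y to meet in a single point while t >= 2, petals leaving out
    different points of W could not both be present, and the inclusions of F1 and
    F2 in the full construction would be proper. But exchanging one point of X
    for one of Y turns the construction into an admissible pair of at least the
    same sizes, which contradicts maximality. *)
Lemma extremal_shape_H W X Y : #|W| = t -> #|X| = k1 - t + 1 -> #|Y| = k2 - t + 1 ->
  [disjoint W & X] -> [disjoint W & Y] ->
  (forall x, x \in X -> x |: W \in next_covers t F1) ->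
  (forall y, y \in Y -> y |: W \in next_covers t F2) ->
  [/\ F1 = genH k1 W X Y, F2 = genH k2 W Y X & minn t 2 <= #|X :&: Y|].
Proof.
move=> cW cX cY dX dY hX hY.
have [[t0 tk1 tk2 _] [F1k F2k cr _ _] hmax] := ext.
have [_ [_ [r3 r4]]] := extremal_room ext.
have s1 := sub_genH ext cW cX cY dX dY hX hY.
have s2 := sub_genH (extremal_sym ext) cW cY cX dY dX hY hX.
have [XY|few] := boolP (minn t 2 <= #|X :&: Y|).
  have np := genH_pair cW t0 tk1 tk2 (ltnW r3) (ltnW r4) cX cY dX dY XY.
  by have [? ?] := extremal_eq_pair ext s1 s2 np.
exfalso.
have [F hF sF] := not_cover_witness ext cW.
have [G hG sG] := not_cover_witness (extremal_sym ext) cW.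
have nWF : ~~ (W \subset F) by apply/negP => /setIidPl e; move: sF; rewrite e cW ltnn.
have nWG : ~~ (W \subset G) by apply/negP => /setIidPl e; move: sG; rewrite e cW ltnn.
have [i iW eF] := petal_shape F1k cW cX tk1 dX hX hF nWF.
have [j jW eG] := petal_shape F2k cW cY tk2 dY hY hG nWG.
have c1 : #|X :&: Y| = 1 /\ 1 < t.
  have a1 : t <= #|X :&: Y| + #|W :\ i :\ j|.
    by apply: leq_trans (petals_meet dX dY iW jW); rewrite -eF -eG; apply: cr.
  have a2 : #|W :\ i :\ j| <= t.-1.
    by rewrite -[in t.-1]cW -(cards_setD1 iW); apply/subset_leq_card/subsetDl.
  by move: few a1 a2 t0; clear; rewrite /minn; case: ltnP; lia.
case: c1 => c1 t1.
have [x] : exists x, x \in X :\: Y.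
  apply/set0Pn; rewrite -cards_eq0; have := cardsID Y X.
  by rewrite c1 cX; move: tk1; clear; lia.
rewrite inE => /andP[xY xX].
have [y] : exists y, y \in Y :\: X.
  apply/set0Pn; rewrite -cards_eq0; have := cardsID X Y.
  by rewrite setIC c1 cY; move: tk2; clear; lia.
rewrite inE => /andP[yX yY].
pose s := tperm x y; pose X' := s @: X.
have sinj : injective s by exact: perm_inj.
have sW w : w \in W -> s w = w.
  move=> wW; apply: tpermD; first by apply: contraTneq xX => ->; rewrite (disjointFr dX wW).
  by apply: contraTneq yY => ->; rewrite (disjointFr dY wW).
have cX' : #|X'| = k1 - t + 1 by rewrite card_imset.
have dX' : [disjoint W & X'].
  apply/pred0P => w /=; apply/negP => /andP[wW /imsetP[z zX e]].
  have : z = w by apply: sinj; rewrite -e sW.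
  by move=> ez; rewrite -ez (disjointFl dX zX) in wW.
have XY' : minn t 2 <= #|X' :&: Y|.
  have [z] : exists z, z \in X :&: Y by apply/set0Pn; rewrite -cards_eq0 c1.
  rewrite inE => /andP[zX zY].
  have : [set z; y] \subset X' :&: Y.
    rewrite subUset !sub1set !inE zY yY !andbT; apply/andP; split; apply/imsetP.
      exists z => //; rewrite tpermD //; first by apply: contraNneq xY => ->.
      by apply: contraNneq yX => ->.
    by exists x => //; rewrite /s tpermL.
  move/subset_leq_card; rewrite cards2.
  have -> : z != y by apply: contraNneq yX => <-.
  by move=> h; apply: leq_trans (geq_minr t 2) h.
have np := genH_pair cW t0 tk1 tk2 (ltnW r3) (ltnW r4) cX' cY dX' dY XY'.
have le1 : #|genH k1 W X Y| <= #|genH k1 W X' Y| by rewrite !(genH_card _ _ cW).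
have le2 : #|genH k2 W Y X| <= #|genH k2 W Y X'|.
  rewrite !(genH_card _ _ cW) // leq_add2r.
  rewrite -(card_imset _ (imset_inj sinj)); apply/subset_leq_card/subsetP => H.
  case/imsetP => H0; rewrite !inE !subsetT /= => /and3P[cH WH HX] ->.
  rewrite card_imset // cH /=; apply/andP; split.
    by apply/subsetP => w wW; rewrite -(sW w wW) imset_f // (subsetP WH).
  have /card_gt0P[z] := HX; rewrite inE => /andP[zH zX].
  by apply/card_gt0P; exists (s z); rewrite inE !imset_f.
have [e1 e2] := extremal_eq ext s1 s2 (leq_trans (leq_mul le1 le2) (hmax _ _ np)).
have [i'] : exists i', i' \in W :\ j.
  by apply/set0Pn; rewrite -cards_eq0 cards_setD1 // cW; move: t1; clear; lia.
rewrite !inE => /andP[ij i'W].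
have h1 : X :|: W :\ i' \in F1 by rewrite e1 inE; apply/orP; right; apply/imsetP; exists i'.
have h2 : Y :|: W :\ j \in F2 by rewrite e2 inE; apply/orP; right; apply/imsetP; exists j.
have := leq_trans (cr _ _ h1 h2) (petals_meet dX dY i'W jW).
rewrite c1 cards_setD1; last by rewrite !inE eq_sym ij.
by rewrite cards_setD1 // cW; move: t1; clear; lia.
Qed.

(** Counting shows that every i in S has the maximal number k1 - t of exchanges. A
    member of F1 missing only j from S then consists of the rest of S and of the
    set of exchanges of i, for any i other than j, so that this set is the same
    set X for all i. *)
Lemma extremal_shape_C S : 1 < t -> S \in next_covers t F1 -> S \in next_covers t F2 ->
  (t + 1) * (k1 - t) + 1 <= #|next_covers t F1| ->
  exists X, [/\ #|X| = k1 - t, [disjoint S & X], F1 = genC1 k1 S X & F2 = genC2 k2 t S X].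
Proof.
move=> t1 S1 S2 many.
have [[t0 tk1 tk2 _] [F1k F2k cr tau1 tau2] hmax] := ext.
have [_ [_ [r3 r4]]] := extremal_room ext.
have /next_coverP[cS /t_coverP covS] := S1.
have /next_coverP[_ /t_coverP covS2] := S2.
have near C : C \in next_covers t F1 -> t <= #|C :&: S|.
  by move=> hC; apply: (extremal_cross_covers ext).
have le i : i \in S -> #|exchanges t F1 S i| <= k1 - t.
  by move=> iS; have := card_exchanges t0 tk1 F1k tau1 cS iS; rewrite S1; lia.
have full i : i \in S -> #|exchanges t F1 S i| = k1 - t.
  move=> iS; apply/eqP; rewrite eqn_leq le //=.
  have := leq_trans many (card_next_covers_exchanges cS near); rewrite S1 (bigD1 i) //=.
  have : \sum_(j in S | j != i) #|exchanges t F1 S j| <= \sum_(j in S :\ i) (k1 - t).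
    rewrite (eq_bigl (fun j => j \in S :\ i)); last by move=> j; rewrite !inE andbC.
    by apply: leq_sum => j; rewrite inE => /andP[_ /le].
  rewrite sum_nat_const cards_setD1 // cS /=; clear; nia.
have miss F : F \in F1 -> ~~ (S \subset F) -> exists2 j, j \in S & S :&: F = S :\ j.
  move=> hF nSF; have [j jS jF] := subsetPn nSF; exists j => //.
  apply/eqP; rewrite eqEcard cards_setD1 // cS /= covS // andbT.
  by apply/subsetP => y; rewrite !inE => /andP[-> yF]; rewrite andbT; apply: contraNneq jF => <-.
have wit i : i \in S -> exists F j, [/\ F \in F1, j \in S, i != j & S :&: F = S :\ j].
  move=> iS; have cSi : #|S :\ i| = t by rewrite cards_setD1 // cS.
  have [F hF small] := not_cover_witness ext cSi.
  have nSF : ~~ (S \subset F).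
    apply/negP => SF; move: small; rewrite (setIidPl _) ?cSi ?ltnn //.
    by apply: subset_trans SF; apply: subsetDl.
  have [j jS e] := miss _ hF nSF; exists F, j; split=> //.
  apply/eqP => ij; move: small; rewrite ij -e -setIA setIid e cards_setD1 // cS /=.
  by rewrite ltnn.
have shape F j i : F \in F1 -> j \in S -> S :&: F = S :\ j -> i \in S -> i != j ->
  exchanges t F1 S i = F :\: S.
  by move=> hF jS e iS; apply: (exchange_shape F1k S1 tk1 (full _ iS) hF jS e iS).
have [i0 i0S] : exists i, i \in S by apply/set0Pn; rewrite -cards_eq0 cS.
have [E0 [j0 [hE0 j0S ij0 eE0]]] := wit _ i0S.
have [E1 [j1 [hE1 j1S ij1 eE1]]] := wit _ j0S.
pose X := E0 :\: S.
(* E0 settles the exchanges of all points but j0. Those of j0 are settled by E1,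
   which is linked to E0 through a third point i2; this needs t >= 2. *)
have [i2] : exists i2, i2 \in S :\ j0 :\ j1.
  apply/set0Pn; rewrite -cards_eq0; have := cardsD1 j1 (S :\ j0).
  by rewrite cards_setD1 // cS /=; move: t1; clear; case: (_ \in _); lia.
rewrite !inE => /and3P[i2j1 i2j0 i2S].
have allX i : i \in S -> exchanges t F1 S i = X.
  move=> iS; have [->|ne] := eqVneq i j0; last exact: (shape _ j0).
  rewrite (shape E1 j1 j0) // -(shape E1 j1 i2) //; exact: (shape _ j0).
have cX : #|X| = k1 - t by rewrite -(allX _ i0S) full.
have dX : [disjoint S & X].
  by apply/pred0P => y /=; rewrite !inE; case: (y \in S).
have form F : F \in F1 -> ~~ (S \subset F) -> exists2 j, j \in S & F = (S :|: X) :\ j.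
  move=> hF nSF; have [j jS e] := miss _ hF nSF; exists j => //.
  have [i] : exists i, i \in S :\ j.
    by apply/set0Pn; rewrite -cards_eq0 cards_setD1 // cS; move: t1; clear; lia.
  rewrite !inE => /andP[ij iS].
  have eX : X = F :\: S by rewrite -(allX i) // (shape F j i).
  apply/setP => y; move/setP/(_ y): e; rewrite eX !inE.
  have [->|] := eqVneq y j; first by rewrite jS /= => ->.
  by case: (y \in S) => //= _ ->.
have np := genC_pair (etrans cS (esym (addn1 t))) dX t0 tk1 tk2 (ltnW r3) (ltnW r4) cX.
suff [s1 s2] : F1 \subset genC1 k1 S X /\ F2 \subset genC2 k2 t S X.
  by have [e1 e2] := extremal_eq_pair ext s1 s2 np; exists X.
split; apply/subsetP => G hG.
  rewrite inE; have [SG|nSG] := boolP (S \subset G).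
    by apply/orP; right; rewrite inE (subsetP F1k).
  by apply/orP; left; have [j jS ->] := form _ hG nSG; apply/imsetP; exists j.
rewrite inE; have [SG|nSG] := boolP (S \subset G).
  by apply/orP; right; rewrite inE (subsetP F2k).
apply/orP; left; rewrite inE (subsetP F2k) //=.
have cSG : #|S :&: G| = t.
  apply/eqP; rewrite eqn_leq covS2 // andbT -ltnS -cS; apply: proper_card.
  by rewrite properE subsetIl; apply: contra nSG => h; apply: subset_trans h (subsetIr _ _).
rewrite setIC cSG eqxx /=.
have [i iS iG] := subsetPn nSG.
have [F [j [hF jS ij eF]]] := wit _ iS.
have nSF : ~~ (S \subset F).
  by apply/subsetPn; exists j => //; apply/negP => jF; move/setP/(_ j): eF; rewrite !inE jS jF eqxx.
have [l lS eFX] := form _ hF nSF.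
have jl : j = l.
  apply/eqP/negPn/negP => jl; move/setP/(_ j): eF.
  by rewrite eFX !inE eqxx jl jS.
have sub : F :&: G \subset (S :\ i :\ j) :|: (G :&: X).
  apply/subsetP => y; rewrite eFX -jl !inE => /andP[/andP[-> /orP[yS|yX]] yG].
    rewrite yS /= andbT; apply/orP; left; by apply: contraNneq iG => <-.
  by rewrite yG yX orbT.
have := leq_trans (cr _ _ hF hG) (subset_leq_card sub).
have := (leq_card_setU (S :\ i :\ j) (G :&: X)).1.
rewrite cards_setD1 ?inE 1?eq_sym ?ij ?jS // cards_setD1 // cS /=; move: t0; clear; lia.
Qed.

End ShapeHC.

(** * Cross t-intersecting families of (t+1)-sets *)

Section CrossCovers.
Variables (T : finType) (t : nat).
Implicit Types (R S U V W Z : {set T}) (P Q : {set {set T}}) (a b c d : T).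

Definition cross_near P Q :=
  [/\ forall R, R \in P -> #|R| = t.+1, forall R, R \in Q -> #|R| = t.+1 &
      forall R S, R \in P -> S \in Q -> t <= #|R :&: S|].

Lemma cross_near_sym P Q : cross_near P Q -> cross_near Q P.
Proof. by case=> cP cQ cr; split=> // R S hR hS; rewrite setIC; apply: cr. Qed.

Lemma card_meet_two R S S' :
  #|R :&: S| + #|R :&: S'| = #|R :&: (S :|: S')| + #|R :&: (S :&: S')|.
Proof. by rewrite setIUr -cardsUI setIACA setIid. Qed.

(** If R misses a point of S :&: S', then by [card_meet_two] its t points in each
    of S and S' already make up t + 1 points of the union. *)
Lemma near_pair_meet S S' R : #|S :&: S'| = t -> #|R| = t.+1 ->
  t <= #|R :&: S| -> t <= #|R :&: S'| -> S :&: S' \subset R \/ R \subset S :|: S'.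
Proof.
move=> cW cR h h'; have [WR|nWR] := boolP (S :&: S' \subset R); [by left|right].
have small : #|R :&: (S :&: S')| < t.
  rewrite -cW setIC; apply: proper_card; rewrite properE subsetIl /=.
  by apply: contra nWR => e; apply: subset_trans e (subsetIr _ _).
apply/setIidPl/eqP; rewrite eqEcard subsetIl cR.
by have := card_meet_two R S S'; lia.
Qed.

(** With at most t - 2 points in S :&: S', R would by [card_meet_two] have t + 2 points
    in the union. So S :&: S' has t - 1 points, all in R, and R has one more point
    in each of S and S'. *)
Lemma far_pair_meet S S' R : #|S :&: S'| < t -> #|R| = t.+1 ->
  t <= #|R :&: S| -> t <= #|R :&: S'| ->
  #|S :&: S'| = t.-1 /\ exists a b, [/\ a \in S :\: S', b \in S' :\: S &
     R = a |: (b |: (S :&: S'))].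
Proof.
move=> far cR h h'.
have h2 := card_meet_two R S S'.
have h3 : #|R :&: (S :|: S')| <= #|R| by apply/subset_leq_card/subsetIl.
have h4 : #|R :&: (S :&: S')| <= #|S :&: S'| by apply/subset_leq_card/subsetIr.
have cU : #|S :&: S'| = t.-1 by lia.
have UR : S :&: S' \subset R.
  by apply/setIidPr/eqP; rewrite eqEcard subsetIr; lia.
split=> //.
have pt A B : A :&: B = S :&: S' -> t <= #|R :&: A| -> exists2 a, a \in R & a \in A :\: B.
  move=> eAB hA; have [a] : exists a, a \in (R :&: A) :\: (S :&: S').
    apply/set0Pn; rewrite -cards_eq0.
    have := cardsID (S :&: S') (R :&: A).
    have : #|R :&: A :&: (S :&: S')| <= #|S :&: S'| by apply/subset_leq_card/subsetIr.
    lia.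
  rewrite -eAB !inE => /andP[nAB /andP[aR aA]]; exists a => //.
  by rewrite inE aA andbT; move: nAB; rewrite aA.
have [a aR aS] := pt _ _ (erefl _) h.
have [b bR bS] := pt _ _ (setIC _ _) h'.
exists a, b; split=> //; apply/esym/eqP; rewrite eqEcard !subUset !sub1set aR bR UR cR /=.
move: aS bS; rewrite !inE => /andP[aS' aS] /andP[bS bS'].
rewrite !cardsU1 cU !inE (negPf aS') (negPf bS) !andbF /= orbF.
have -> : a != b by apply: contraNneq bS => <-.
lia.
Qed.

(** S and S' have two private points each; by [far_pair_meet] a member of P takes
    one of either pair and all of U. *)
Lemma far_pair_grid P Q R0 S S' : cross_near P Q -> R0 \in P -> S \in Q -> S' \in Q ->
  #|S :&: S'| < t -> exists U a1 a2 b1 b2,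
   [/\ [/\ #|U| = t.-1, uniq [:: a1; a2; b1; b2] & all [predC U] [:: a1; a2; b1; b2]],
       S = a1 |: (a2 |: U), S' = b1 |: (b2 |: U) &
       forall R, R \in P -> R \in [:: a1 |: (b1 |: U); a2 |: (b2 |: U);
                                  a1 |: (b2 |: U); a2 |: (b1 |: U)]].
Proof.
case=> cP cQ cr hR0 hS hS' far.
have meet R : R \in P -> _ := fun hR =>
  far_pair_meet far (cP _ hR) (cr _ _ hR hS) (cr _ _ hR hS').
have [cU _] := meet _ hR0.
have t0 : 0 < t by lia.
have dif A B : A \in Q -> #|A :&: B| = t.-1 -> exists a1 a2, a1 != a2 /\ A :\: B = [set a1; a2].
  move=> hA cAB; have : #|A :\: B| == 2.
    by apply/eqP; have := cardsID B A; rewrite cAB (cQ _ hA); lia.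
  by case/cards2P => a1 [a2 [ne e]]; exists a1, a2.
have [a1 [a2 [na eA]]] := dif _ _ hS cU.
have [|b1 [b2 [nb eB]]] := dif S' S hS'; first by rewrite setIC.
have sA : S = a1 |: (a2 |: (S :&: S')) by rewrite setUA -eA setUC setID.
have sB : S' = b1 |: (b2 |: (S :&: S')) by rewrite setUA -eB setUC [S :&: S']setIC setID.
have inA x : x \in [set a1; a2] -> (x \in S) && (x \notin S') by rewrite -eA inE andbC.
have inB x : x \in [set b1; b2] -> (x \in S') && (x \notin S) by rewrite -eB inE andbC.
have /andP[a1S a1S'] := inA a1 (set21 _ _); have /andP[a2S a2S'] := inA a2 (set22 _ _).
have /andP[b1S' b1S] := inB b1 (set21 _ _); have /andP[b2S' b2S] := inB b2 (set22 _ _).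
exists (S :&: S'), a1, a2, b1, b2; split=> //.
  split=> //; last by rewrite /= !inE (negPf a1S') (negPf a2S') (negPf b1S) (negPf b2S) !andbF.
  rewrite /= !inE !negb_or na nb !andbT /=.
  by apply/andP; split; apply/andP; split; apply: contraTneq isT => e; move: b1S b2S;
    rewrite -?e ?a1S ?a2S.
move=> R hR; have [_ [a [b [aA bB ->]]]] := meet _ hR.
move: aA bB; rewrite eA eB !inE => /orP[] /eqP -> /orP[] /eqP ->; rewrite !eqxx ?orbT //.
Qed.

Lemma card_le_list P (s : seq {set T}) : (forall R, R \in P -> R \in s) -> #|P| <= size s.
Proof.
move=> h; rewrite cardE; apply: uniq_leq_size (enum_uniq _) _ => R.
by rewrite mem_enum; apply: h.
Qed.

Lemma card_in_four P S1 S2 V1 V2 : (forall R, R \in P -> R \in [:: S1; S2; V1; V2]) ->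
  #|P| <= (S1 \in P) + (S2 \in P) + (V1 \in P) + (V2 \in P).
Proof.
move=> h; have : P \subset \bigcup_(R <- [:: S1; S2; V1; V2]) (if R \in P then [set R] else set0).
  apply/subsetP => R hR; have := h _ hR; rewrite !big_cons big_nil !inE.
  by case/or4P => /eqP eR; move: hR; rewrite eR => hR; rewrite hR !inE eqxx ?orbT.
move/subset_leq_card/leq_trans; apply; rewrite !big_cons big_nil setU0.
have c1 R : #|if R \in P then [set R] else set0| = (R \in P).
  by case: ifP => _; rewrite ?cards1 ?cards0.
apply: leq_trans (leq_card_setU _ _).1 _; rewrite c1 -!addnA leq_add2l.
apply: leq_trans (leq_card_setU _ _).1 _; rewrite c1 leq_add2l.
by apply: leq_trans (leq_card_setU _ _).1 _; rewrite !c1.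
Qed.

Lemma grid_far U a1 a2 b1 b2 : #|U| < t -> uniq [:: a1; a2; b1; b2] ->
  #|(a1 |: (b1 |: U)) :&: (a2 |: (b2 |: U))| < t.
Proof.
move=> cU; rewrite /= !inE !negb_or => /and4P[/and3P[a12 ab11 ab12] /andP[ab21 ab22] b12 _].
apply: leq_ltn_trans cU; apply/subset_leq_card/subsetP => x; rewrite !inE.
case/andP => /or3P[/eqP ->|/eqP ->|->] //; first by rewrite (negPf a12) (negPf ab12).
by rewrite [b1 == a2]eq_sym (negPf ab21) (negPf b12).
Qed.

(** The two given corners of the grid force Q onto the grid with the same other
    diagonal. The corners of that diagonal are far apart, so they cannot be split
    between P and Q; a product above 8 then requires one of them to be in both
    families and the other one in neither. *)
Lemma far_far P Q U a1 a2 b1 b2 : cross_near P Q ->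
  #|U| = t.-1 -> 0 < t -> uniq [:: a1; a2; b1; b2] -> all [predC U] [:: a1; a2; b1; b2] ->
  a1 |: (b1 |: U) \in P -> a2 |: (b2 |: U) \in P ->
  (forall R, R \in P -> R \in [:: a1 |: (b1 |: U); a2 |: (b2 |: U);
                                  a1 |: (b2 |: U); a2 |: (b1 |: U)]) ->
  8 < #|P| * #|Q| -> #|P| * #|Q| <= 9 /\
  ((a1 |: (b2 |: U) \in P) && (a1 |: (b2 |: U) \in Q)
   || (a2 |: (b1 |: U) \in P) && (a2 |: (b1 |: U) \in Q)).
Proof.
move=> cr cU t0 u nU hP1 hP2 hP big.
have ltU : #|U| < t by rewrite cU; lia.
have far := grid_far ltU u.
have u' : uniq [:: a1; a2; b2; b1].
  move: u; rewrite /= !inE !negb_or => /and4P[/and3P[-> -> ->] /andP[-> ->] b12 _].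
  by rewrite [b2 == b1]eq_sym b12.
have [_ _ crPQ] := cr.
have split1 : ~~ ((a1 |: (b2 |: U) \in P) && (a2 |: (b1 |: U) \in Q)).
  by apply/negP => /andP[h1 h2]; have := crPQ _ _ h1 h2; rewrite leqNgt (grid_far ltU u').
have split2 : ~~ ((a2 |: (b1 |: U) \in P) && (a1 |: (b2 |: U) \in Q)).
  by apply/negP => /andP[h1 h2]; have := crPQ _ _ h1 h2; rewrite leqNgt setIC (grid_far ltU u').
have cp := card_in_four hP.
have cq : #|Q| <= 2 + (a1 |: (b2 |: U) \in Q) + (a2 |: (b1 |: U) \in Q).
  have hQ' R : R \in Q -> R \in [:: a1 |: (a2 |: U); b1 |: (b2 |: U);
     a1 |: (b2 |: U); a2 |: (b1 |: U)].
    move=> hR; have [_ _ crQP] := cross_near_sym cr.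
    have [_ cQ' _] := cr.
    have [_ [a [b [aA bB ->]]]] :=
      far_pair_meet far (cQ' _ hR) (crQP _ _ hR hP1) (crQP _ _ hR hP2).
    have eU : (a1 |: (b1 |: U)) :&: (a2 |: (b2 |: U)) = U.
      apply/setP => x; rewrite !inE; case: (x \in U); rewrite ?orbT // !orbF.
      move: u; rewrite /= !inE !negb_or => /and4P[/and3P[a12 ab11 ab12] /andP[ab21 ab22] b12 _].
      have [->|_] := eqVneq x a1; first by rewrite (negPf a12) (negPf ab12).
      have [->|_] := eqVneq x b1; last by [].
      by rewrite [b1 == a2]eq_sym (negPf ab21) (negPf b12).
    rewrite eU; move: aA bB; rewrite !inE => /andP[n1 /or3P[/eqP ->|/eqP ->|xU]];
     [| |by rewrite xU !orbT in n1] => /andP[n2 /or3P[/eqP ->|/eqP ->|yU]];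
     try by rewrite yU !orbT in n2.
    - by rewrite eqxx.
    - by rewrite eqxx !orbT.
    - by rewrite setUCA eqxx !orbT.
    - by rewrite eqxx !orbT.
  apply: leq_trans (card_in_four hQ') _; rewrite -!addnA addnA leq_add2r.
  by case: (_ \in Q); case: (_ \in Q).
move: cp cq big split1 split2; rewrite hP1 hP2.
case: (a1 |: (b2 |: U) \in P); case: (a2 |: (b1 |: U) \in P);
case: (a1 |: (b2 |: U) \in Q); case: (a2 |: (b1 |: U) \in Q) => //=;
move=> cp cq big _ _; (split=> //; try by have := leq_mul cp cq); 
by have := leq_trans big (leq_mul cp cq).
Qed.

(** With three members P contains a diagonal of its grid. Removing U, the outcome
    is the path a, b, c, d for P and the path a, c, b, d for Q. *)
Lemma far_pair_case P Q S S' : cross_near P Q -> S \in Q -> S' \in Q -> #|S :&: S'| < t ->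
  0 < t -> 2 < #|P| -> 8 < #|P| * #|Q| -> #|P| * #|Q| <= 9 /\
  exists U a b c d,
   [/\ #|U| = t.-1, uniq [:: a; b; c; d],
       [/\ a |: (b |: U) \in P, b |: (c |: U) \in P & c |: (d |: U) \in P] &
       [/\ a |: (c |: U) \in Q, b |: (c |: U) \in Q & b |: (d |: U) \in Q]].
Proof.
move=> cr hS hS' far t0 p3 big.
have [R0 hR0] : exists R, R \in P by apply/card_gt0P; apply: leq_trans p3.
have [U [a1 [a2 [b1 [b2 [[cU u nU] eS eS' hP]]]]]] := far_pair_grid cr hR0 hS hS' far.
have wlog_diag c1 c2 d1 d2 : uniq [:: c1; c2; d1; d2] -> all [predC U] [:: c1; c2; d1; d2] ->
  S = c1 |: (c2 |: U) -> S' = d1 |: (d2 |: U) ->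
  c1 |: (d1 |: U) \in P -> c2 |: (d2 |: U) \in P ->
  (forall R, R \in P -> R \in [:: c1 |: (d1 |: U); c2 |: (d2 |: U);
                                  c1 |: (d2 |: U); c2 |: (d1 |: U)]) ->
  #|P| * #|Q| <= 9 /\ exists U a b c d,
   [/\ #|U| = t.-1, uniq [:: a; b; c; d],
       [/\ a |: (b |: U) \in P, b |: (c |: U) \in P & c |: (d |: U) \in P] &
       [/\ a |: (c |: U) \in Q, b |: (c |: U) \in Q & b |: (d |: U) \in Q]].
  move=> u' nU' eC eD hP1 hP2 hP'.
  have [le mid] := far_far cr cU t0 u' nU' hP1 hP2 hP' big; split=> //.
  move: u'; rewrite /= !inE !negb_or => /and4P[/and3P[n1 n2 n3] /andP[n4 n5] n6 _].
  case/orP: mid => /andP[mP mQ].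
    exists U, d1, c1, d2, c2; split=> //; last by rewrite -eC -eD.
      by rewrite /= !inE !negb_or n6 n3 n1 ![_ == c1]eq_sym ![_ == c2]eq_sym n2 n4 n5.
    by rewrite [d1 |: (c1 |: _)]setUCA [d2 |: (c2 |: _)]setUCA.
  exists U, d2, c2, d1, c1; split=> //.
  - rewrite /= !inE !negb_or [d2 == c2]eq_sym n5 [d2 == d1]eq_sym n6 [d2 == c1]eq_sym n3.
    by rewrite n4 [c2 == c1]eq_sym n1 [d1 == c1]eq_sym n2.
  - by rewrite [d2 |: (c2 |: _)]setUCA [d1 |: (c1 |: _)]setUCA.
  by rewrite [d2 |: (d1 |: _)]setUCA [c2 |: (c1 |: _)]setUCA -eC -eD.
have := card_in_four hP => cp.
have [/andP[h1 h2]|nd] := boolP ((a1 |: (b1 |: U) \in P) && (a2 |: (b2 |: U) \in P)).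
  exact: (wlog_diag a1 a2 b1 b2).
have [h1 h2] : a1 |: (b2 |: U) \in P /\ a2 |: (b1 |: U) \in P.
  move: nd cp p3; case: (a1 |: (b1 |: U) \in P); case: (a2 |: (b2 |: U) \in P) => //=;
  case: (a1 |: (b2 |: U) \in P); case: (a2 |: (b1 |: U) \in P) => //= _ cp p3;
  by have := leq_trans p3 cp.
apply: (wlog_diag a1 a2 b2 b1) => //.
- move: u; rewrite /= !inE !negb_or => /and4P[/and3P[-> -> ->] /andP[-> ->] b12 _].
  by rewrite [b2 == b1]eq_sym b12.
- by move: nU; rewrite /= => /and4P[-> -> -> /andP[-> _]].
- by rewrite setUCA.
move=> R /hP; rewrite !inE => /or4P[] ->; rewrite ?orbT //.
Qed.

End CrossCovers.

(** * Classification of extremal pairs *)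

Section OneSided.
Variables (T : finType) (k1 k2 t : nat) (F1 F2 : {set {set T}}).
Hypothesis ext : extremal k1 k2 t F1 F2.
Implicit Types (C F G R S W X Y Z : {set T}).
Local Notation P := (next_covers t F1).
Local Notation Q := (next_covers t F2).

Let t0 : 0 < t. Proof. by case: ext => -[]. Qed.
Let tk1 : t < k1. Proof. by case: ext => -[]. Qed.
Let F1k : F1 \subset ksubsets [set: T] k1. Proof. by case: ext => _ []. Qed.
Let tau1 : t + 1 <= tau t F1. Proof. by case: ext => _ []. Qed.

Lemma extremal_cross_near : cross_near t P Q.
Proof.
split=> [R /next_coverP[]|R /next_coverP[]|R S] //.
exact: (extremal_cross_covers ext).
Qed.

Lemma card_covers_above W : #|W| = t -> #|[set C in P | W \subset C]| <= k1 - t + 1.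
Proof. exact: (card_next_covers_above t0 tk1 F1k tau1). Qed.

Definition star_points W : {set T} := [set x | (x \notin W) && (x |: W \in P)].

Lemma star_points_disj W : [disjoint W & star_points W].
Proof. by apply/pred0P => x /=; rewrite !inE; case: (x \in W). Qed.

Lemma star_points_card W : #|W| = t -> k1 - t + 1 <= #|[set C in P | W \subset C]| ->
  #|star_points W| = k1 - t + 1.
Proof.
move=> cW many.
have e : [set C in P | W \subset C] = [set x |: W | x in star_points W].
  have [A [cA dA] hA] := next_covers_above t0 tk1 F1k tau1 cW.
  apply/setP => C; rewrite inE; apply/andP/imsetP => [[hC WC]|[x]].
    have [x xA eC] := hA _ hC WC; exists x => //.
    by rewrite inE (disjointFr dA xA) -eC.
  by rewrite inE => /andP[_ hx] ->; rewrite subsetUr.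
have inj : {in star_points W &, injective (fun x => x |: W)}.
  move=> x y; rewrite !inE => /andP[xW _] /andP[yW _] exy.
  have : x \in y |: W by rewrite -exy setU11.
  by rewrite !inE (negPf xW) orbF => /eqP.
have le := card_covers_above cW; rewrite e card_in_imset // in many le.
by apply/eqP; rewrite eqn_leq le.
Qed.

(** By [near_pair_meet] a next cover not above S :&: S' is the union S :|: S' with a
    point of S :&: S' removed. *)
Lemma near_pair_bound S S' : S \in Q -> S' \in Q -> #|S :&: S'| = t ->
  #|P| <= #|[set C in P | S :&: S' \subset C]| + t.
Proof.
have [cP cQ cr] := extremal_cross_near => hS hS' cW.
have cZ : #|S :|: S'| = t.+2 by have := cardsUI S S'; rewrite cW (cQ _ hS) (cQ _ hS'); lia.
apply: (@leq_trans #|[set C in P | S :&: S' \subset C] :|: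
                     [set (S :|: S') :\ w | w in S :&: S']|).
  apply/subset_leq_card/subsetP => C hC; rewrite !inE.
  have cC := cP _ hC; have [WC|nWC] := boolP (S :&: S' \subset C).
    by move: hC; rewrite inE => ->.
  apply/orP; right.
  have [WC|CZ] := near_pair_meet cW cC (cr _ _ hC hS) (cr _ _ hC hS').
    by rewrite WC in nWC.
  have [w wW wC] := subsetPn nWC; apply/imsetP; exists w => //.
  have wZ : w \in S :|: S' by move: wW; rewrite !inE => /andP[->].
  apply/eqP; rewrite eqEcard cards_setD1 // cZ cC /= leqnn andbT.
  apply/subsetP => y yC; rewrite in_setD1 (subsetP CZ) // andbT.
  by apply: contraNneq wC => <-.
apply: leq_trans (leq_card_setU _ _).1 _; rewrite leq_add2l -[X in _ <= X]cW.
exact: leq_imset_card.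
Qed.

Lemma far_pair_bound S S' : S \in Q -> S' \in Q -> #|S :&: S'| < t -> #|P| <= 4.
Proof.
move=> hS hS' far; have [[R hR] _] := extremal_covers ext.
have [U [a1 [a2 [b1 [b2 [_ _ _ h]]]]]] := far_pair_grid extremal_cross_near hR hS hS' far.
exact: card_le_list h.
Qed.

Lemma lone_cover_bound S : Q = [set S] ->
  (S \notin P -> #|P| <= 2 * (k1 - t + 1)) /\ (S \in P -> #|P| <= (t + 1) * (k1 - t) + 1).
Proof.
move=> eQ; have [cP cQ cr] := extremal_cross_near.
have hS : S \in Q by rewrite eQ inE.
have near C : C \in P -> t <= #|C :&: S| by move=> hC; apply: cr.
split=> h.
  exact: (card_next_covers_near_noncover t0 tk1 F1k tau1 (cQ _ hS) near h).
exact: (card_next_covers_near_cover t0 tk1 F1k tau1 h near).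
Qed.

Lemma two_covers : #|Q| = 2 ->
  exists S S', [/\ S \in Q, S' \in Q, Q = [set S; S'] & #|S :&: S'| <= t].
Proof.
have [_ cQ _] := extremal_cross_near.
move/eqP/cards2P => [S [S' [ne e]]]; exists S, S'.
have hS : S \in Q by rewrite e set21.
have hS' : S' \in Q by rewrite e set22.
split=> //; rewrite -ltnS -(cQ _ hS); apply: proper_card; rewrite properE subsetIl /=.
apply: contra ne => sub; rewrite eqEcard !cQ // leqnn andbT.
by apply: subset_trans sub (subsetIr _ _).
Qed.

End OneSided.

(** If some R0 misses a point of S :&: S', it lies in S :|: S'. A member outside
    S :|: S' would be S :&: S' with one point added, and would meet R0 in fewer
    than t points. *)
Lemma star_or_simplex (T : finType) t (PQ : {set {set T}}) S S' :
  (forall R, R \in PQ -> #|R| = t.+1) ->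
  (forall R R', R \in PQ -> R' \in PQ -> t <= #|R :&: R'|) ->
  S \in PQ -> S' \in PQ -> S != S' ->
  [/\ #|S :&: S'| = t, #|S :|: S'| = t.+2 &
   (forall R, R \in PQ -> S :&: S' \subset R) \/ (forall R, R \in PQ -> R \subset S :|: S')].
Proof.
move=> cPQ cr hS hS' ne.
have cW : #|S :&: S'| = t.
  apply/eqP; rewrite eqn_leq cr // andbT -ltnS -(cPQ _ hS); apply: proper_card.
  rewrite properE subsetIl /=; apply: contra ne => sub.
  by rewrite eqEcard !cPQ // leqnn andbT; apply: subset_trans sub (subsetIr _ _).
have cZ : #|S :|: S'| = t.+2 by have := cardsUI S S'; rewrite cW (cPQ _ hS) (cPQ _ hS'); lia.
split=> //.
have meet R : R \in PQ -> S :&: S' \subset R \/ R \subset S :|: S'.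
  by move=> hR; apply: (near_pair_meet cW (cPQ _ hR)); apply: cr.
have [/forall_inP|] := boolP [forall R in PQ, S :&: S' \subset R]; first by left.
rewrite negb_forall_in => /exists_inP[R0 hR0 nW0]; right=> R hR.
have R0Z : R0 \subset S :|: S' by case: (meet _ hR0) => // e; rewrite e in nW0.
case: (meet _ hR) => // WR; apply/subsetPn => -[z zR zZ].
have eR : R = z |: (S :&: S').
  apply/esym/eqP; rewrite eqEcard subUset sub1set zR WR cPQ // cardsU1 cW.
  have -> : z \notin S :&: S'.
    apply: contra zZ => h; apply: (subsetP _ _ h).
    by apply: subset_trans (subsetIl _ _) (subsetUl _ _).
  by rewrite add1n leqnn.
have : t <= #|(S :&: S') :&: R0|.
  apply: leq_trans (cr _ _ hR hR0) _; apply/subset_leq_card/subsetP => y.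
  rewrite eR in_setI in_setU1 => /andP[/orP[/eqP ->|yW] yR0]; last by rewrite inE yW.
  by rewrite (subsetP R0Z _ yR0) in zZ.
rewrite leqNgt => /negP; apply; rewrite -cW; apply: proper_card.
rewrite properE subsetIl /=; apply: contra nW0 => h; exact: subset_trans h (subsetIr _ _).
Qed.

Lemma simplex_full (T : finType) t (Z : {set T}) (P : {set {set T}}) : #|Z| = t.+2 ->
  (forall R, R \in P -> #|R| = t.+1) -> (forall R, R \in P -> R \subset Z) ->
  #|P| <= t.+2 /\ (t.+2 <= #|P| -> forall z, z \in Z -> Z :\ z \in P).
Proof.
move=> cZ cP PZ.
have sub : P \subset [set R : {set T} | (R \subset Z) && (#|R| == t.+1)].
  by apply/subsetP => R hR; rewrite inE PZ // cP //=.
have c : #|[set R : {set T} | (R \subset Z) && (#|R| == t.+1)]| = t.+2.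
  by rewrite cards_draws cZ binSn.
split=> [|many z zZ]; first by rewrite -[X in _ <= X]c subset_leq_card.
have -> : P = [set R : {set T} | (R \subset Z) && (#|R| == t.+1)].
  by apply/eqP; rewrite eqEcard sub c.
by rewrite inE subsetDl cards_setD1 // cZ eqxx.
Qed.

Lemma product_full a b x y : 0 < y -> 0 < x -> a <= x -> b <= y -> x * y <= a * b ->
  x <= a /\ y <= b.
Proof.
move=> y0 x0 ax by_ le.
split; [rewrite -(leq_pmul2r y0)|rewrite -(leq_pmul2l x0)]; apply: leq_trans le _.
  by rewrite leq_mul2l by_ orbT.
by rewrite leq_mul2r ax orbT.
Qed.

Definition extremal_shape (T : finType) (k1 k2 t : nat) (F1 F2 : {set {set T}}) : Prop :=
  [\/ exists Z : {set T}, [/\ #|Z| = t + 2, F1 = genA k1 t Z & F2 = genA k2 t Z],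
      1 < t /\ exists S X : {set T}, [/\ #|S| = t + 1, #|X| = k1 - t, [disjoint S & X],
         F1 = genC1 k1 S X & F2 = genC2 k2 t S X],
      t = 1 /\ exists a b c d : T, [/\ uniq [:: a; b; c; d], F1 = genB k1 a c b d
         & F2 = genB k2 a b c d] |
      exists W X Y : {set T}, [/\ #|W| = t, #|X| = k1 - t + 1 /\ #|Y| = k2 - t + 1,
         [disjoint W & X] /\ [disjoint W & Y], minn t 2 <= #|X :&: Y| &
         F1 = genH k1 W X Y /\ F2 = genH k2 W Y X] ].

Section Classification.
Variables (T : finType) (k1 k2 t : nat) (F1 F2 : {set {set T}}).
Hypothesis ext : extremal k1 k2 t F1 F2.
Hypothesis k21 : k2 <= k1.
Implicit Types (C F G R S W X Y Z : {set T}).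
Local Notation P := (next_covers t F1).
Local Notation Q := (next_covers t F2).

Let t0 : 0 < t. Proof. by case: ext => -[]. Qed.
Let tk1 : t < k1. Proof. by case: ext => -[]. Qed.
Let tk2 : t < k2. Proof. by case: ext => -[]. Qed.
Let geA := covers_ge_A ext.
Let geH := covers_ge_H ext k21.
Let ext' := extremal_sym ext.

Let nine : 8 < #|P| * #|Q|.
Proof. by apply: leq_trans geA; move: t0; clear; nia. Qed.

Lemma shape_of_star W : #|W| = t ->
  k1 - t + 1 <= #|[set C in P | W \subset C]| ->
  k2 - t + 1 <= #|[set C in Q | W \subset C]| -> extremal_shape k1 k2 t F1 F2.
Proof.
move=> cW h1 h2; constructor 4.
exists W, (star_points t F1 W), (star_points t F2 W).
have cX := star_points_card ext cW h1.
have cY := star_points_card ext' cW h2.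
have dX := star_points_disj t F1 W; have dY := star_points_disj t F2 W.
have [||e1 e2 XY] := extremal_shape_H ext cW cX cY dX dY.
- by move=> x; rewrite inE => /andP[].
- by move=> x; rewrite inE => /andP[].
by split.
Qed.

Lemma shape_one_second : #|Q| = 1 -> extremal_shape k1 k2 t F1 F2.
Proof.
move=> q1; have /eqP/cards1P[S eQ] := q1.
have [b1 b2] := lone_cover_bound ext eQ.
have gH := geH; have geC := covers_ge_C ext; have geS := covers_ge_H_small ext.
rewrite q1 !muln1 in gH geC geS.
have [hS|nS] := boolP (S \in P); last first.
  exfalso; have := b1 nS; have [ek|nk] := eqVneq k2 t.+1.
    by have := geS ek; move: t0 tk1; clear; lia.
  by move: gH tk1 tk2 nk k21; clear; nia.
have [t1|t1] := leqP t 1; last first.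
  constructor 2; split=> //.
  have hQ : S \in Q by rewrite eQ inE.
  have [X [cX dX e1 e2]] := extremal_shape_C ext t1 hS hQ geC.
  by exists S, X; split=> //; have /next_coverP[-> _] := hS; rewrite addn1.
exfalso; have {b1 b2}h := b2 hS; have e : t = 1 by move: t1 t0; clear; lia.
by move: gH h tk1 tk2; rewrite e; clear; nia.
Qed.

(** With a single next cover of F1 there are at most (t+1)(k2-t)+1 or 2(k2-t+1) of
    F2; as k2 is at most k1, this falls short of (k1-t+1)(k2-t+1) or of (t+2)^2. *)
Lemma not_one_first : #|P| != 1.
Proof.
apply/eqP => p1; have /eqP/cards1P[S eP] := p1.
have [b1 b2] := lone_cover_bound ext' eP.
have gH := geH; have gA := geA; rewrite p1 !mul1n in gH gA.
have [s2 es2] : exists s, k2 = t + s.+1 by exists (k2 - t.+1); move: tk2; clear; lia.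
have [s1 es1] : exists s, k1 = t + s.+1 by exists (k1 - t.+1); move: tk1; clear; lia.
have e1 : k1 - t = s1.+1 by move: es1; clear; lia.
have e2 : k2 - t = s2.+1 by move: es2; clear; lia.
have s12 : s2 <= s1 by move: es1 es2 k21; clear; lia.
have [hS|nS] := boolP (S \in Q).
  have h := b2 hS; rewrite e1 e2 in gH h.
  have {}gH := leq_trans gH h; have {}gA := leq_trans gA h.
  have st : s1 < t by move: gH s12; clear; nia.
  by move: gA st s12; clear; nia.
have h := b1 nS; rewrite e1 e2 in gH h.
have {}gH := leq_trans gH h; have {}gA := leq_trans gA h.
by move: gH gA s12 t0; clear; nia.
Qed.

(** Such a bound would give 3(s-t+1) <= 2(s+1), that is s + 1 <= 3t, and then
    (t+2)^2 <= 6t. *)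
Let no_near_bound s : s = k1 \/ s = k2 -> t.+1 < k2 -> ~ #|P| * #|Q| <= 2 * (s + 1).
Proof.
move=> hs tk2' h.
have gH := leq_trans geH h; have gA := leq_trans geA h.
have gs : 3 * (s - t + 1) <= 2 * (s + 1).
  apply: leq_trans gH; case: hs => ->; first by rewrite leq_mul2r; move: tk2'; clear; lia.
  by rewrite mulnC leq_mul2l; move: tk2' k21; clear; lia.
by move: gs gA t0; clear; nia.
Qed.

Lemma not_two_first : #|P| != 2.
Proof.
apply/eqP => p2; have [S [S' [hS hS' eP le]]] := two_covers ext' p2.
have [near|far] := eqVneq #|S :&: S'| t; last first.
  have lt : #|S :&: S'| < t by rewrite ltn_neqAle far.
  have := far_pair_bound ext' hS hS' lt.
  by move: nine; rewrite p2; clear; lia.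
have := near_pair_bound ext' hS hS' near.
have := card_covers_above ext' near => h1 h2.
have q : #|Q| <= k2 + 1 by move: h1 h2 tk2; clear; lia.
have [ek|nk] := eqVneq k2 t.+1.
  by move: geA q t0; rewrite p2 ek; clear; nia.
apply: (@no_near_bound k2); [by right|by move: nk tk2; clear; lia|].
by rewrite p2 leq_mul2l q.
Qed.

Lemma shape_two_second : #|Q| = 2 -> extremal_shape k1 k2 t F1 F2.
Proof.
move=> q2; have [S [S' [hS hS' eQ le]]] := two_covers ext q2.
have [near|far] := eqVneq #|S :&: S'| t; last first.
  have lt : #|S :&: S'| < t by rewrite ltn_neqAle far.
  have := far_pair_bound ext hS hS' lt.
  by move: nine; rewrite q2; clear; lia.
have h1 := near_pair_bound ext hS hS' near.
have h2 := card_covers_above ext near.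
have p : #|P| <= k1 + 1 by move: h1 h2 tk1; clear; lia.
have [ek|nk] := eqVneq k2 t.+1; last first.
  exfalso; apply: (@no_near_bound k1); [by left|by move: nk tk2; clear; lia|].
  by rewrite q2 mulnC leq_mul2l p.
have := covers_ge_H_small ext ek; rewrite q2 => big.
apply: (shape_of_star near); first by move: big h1 tk1; clear; lia.
have -> : [set C in Q | S :&: S' \subset C] = Q.
  apply/setP => C; rewrite inE eQ !inE.
  by apply/andb_idr => /orP[] /eqP ->; rewrite ?subsetIl ?subsetIr.
by rewrite q2; move: ek; clear; lia.
Qed.

Lemma shape_far : (exists S S', [/\ S \in Q, S' \in Q & #|S :&: S'| < t])
    \/ (exists S S', [/\ S \in P, S' \in P & #|S :&: S'| < t]) ->
  2 < #|P| -> 2 < #|Q| -> extremal_shape k1 k2 t F1 F2.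
Proof.
move=> far p3 q3.
have t1 : #|P| * #|Q| <= 9 -> t = 1.
  by move=> h; have := leq_trans geA h; move: t0; clear; nia.
have empty (U : {set T}) : t = 1 -> #|U| = t.-1 -> U = set0.
  by move=> -> /eqP; rewrite cards_eq0 => /eqP.
case: far => -[S [S' [hS hS' far]]].
  have [/t1 e [U [a [b [c [d [cU u [h1 h2 h3] [h4 h5 h6]]]]]]]] :=
    far_pair_case (extremal_cross_near ext) hS hS' far t0 p3 nine.
  rewrite (empty U e cU) !setU0 in h1 h2 h3 h4 h5 h6.
  constructor 3; split=> //; exists a, b, c, d.
  by have [? ?] := extremal_shape_B ext e u h1 h2 h3 h4 h5 h6.
have nine' : 8 < #|Q| * #|P| by rewrite mulnC nine.
have [] := far_pair_case (extremal_cross_near ext') hS hS' far t0 q3 nine'.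
rewrite mulnC => /t1 e [U [a [b [c [d [cU u [h1 h2 h3] [h4 h5 h6]]]]]]].
rewrite (empty U e cU) !setU0 in h1 h2 h3 h4 h5 h6.
have [e1 e2] := extremal_shape_B ext' e u h1 h2 h3 h4 h5 h6.
constructor 3; split=> //; exists a, c, b, d; split=> //.
move: u; rewrite /= !inE !negb_or => /and4P[/and3P[-> -> ->] /andP[bc ->] -> _].
by rewrite eq_sym bc.
Qed.

Theorem extremal_classification : extremal_shape k1 k2 t F1 F2.
Proof.
have [q1|nq1] := eqVneq #|Q| 1; first exact: shape_one_second.
have [q2|nq2] := eqVneq #|Q| 2; first exact: shape_two_second.
have /andP[q0 _] := card_second_covers ext.
have /andP[p0 _] := card_second_covers ext'.
have q3 : 2 < #|Q| by move: nq1 nq2 q0; clear; lia.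
have p3 : 2 < #|P| by move: not_one_first not_two_first p0; clear; lia.
have [far|near] := boolP [exists S, exists S', (S \in Q) && (S' \in Q) && (#|S :&: S'| < t)
                   || (S \in P) && (S' \in P) && (#|S :&: S'| < t)].
  apply: shape_far => //.
  case/existsP: far => S /existsP[S' /orP[] /andP[/andP[h h'] lt]]; [left|right];
  by exists S, S'.
have [cP cQ cr] := extremal_cross_near ext.
have cPQ R : R \in P :|: Q -> #|R| = t.+1 by rewrite inE => /orP[/cP|/cQ].
have crPQ R R' : R \in P :|: Q -> R' \in P :|: Q -> t <= #|R :&: R'|.
  rewrite !in_setU => /orP[hR|hR] /orP[hR'|hR'].
  - rewrite leqNgt; apply: contra near => lt.
    by apply/existsP; exists R; apply/existsP; exists R'; rewrite hR hR' lt orbT.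
  - exact: cr.
  - by rewrite setIC; apply: cr.
  rewrite leqNgt; apply: contra near => lt.
  by apply/existsP; exists R; apply/existsP; exists R'; rewrite hR hR' lt.
have [S [S' [hS hS' ne]]] : exists S S', [/\ S \in P, S' \in P & S != S'].
  have [S hS] : exists S, S \in P by apply/card_gt0P.
  have /card_gt0P[S'] : 0 < #|P :\ S|.
    by rewrite cards_setD1 // -subn1 subn_gt0; apply: ltnW.
  by rewrite in_setD1 => /andP[ne hS']; exists S, S'; rewrite eq_sym.
have hSu : S \in P :|: Q by rewrite in_setU hS.
have hSu' : S' \in P :|: Q by rewrite in_setU hS'.
have [cW cZ [star|simp]] := star_or_simplex cPQ crPQ hSu hSu' ne.
  have eP : [set C in P | S :&: S' \subset C] = P.
    by apply/setP => C; rewrite inE; apply/andb_idr => hC; apply: star; rewrite in_setU hC.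
  have eQ : [set C in Q | S :&: S' \subset C] = Q.
    by apply/setP => C; rewrite inE; apply/andb_idr => hC; apply: star; rewrite in_setU hC orbT.
  have := card_covers_above ext cW; have := card_covers_above ext' cW.
  rewrite eP eQ => le2 le1.
  have geH' : (k1 - t + 1) * (k2 - t + 1) <= #|P| * #|Q| by rewrite mulnC geH.
  have [h1 h2] := product_full (ltn_addl _ (ltnSn 0)) (ltn_addl _ (ltnSn 0)) le1 le2 geH'.
  by apply: (shape_of_star cW); rewrite ?eP ?eQ.
have simpP R : R \in P -> R \subset S :|: S' by move=> hR; apply: simp; rewrite in_setU hR.
have simpQ R : R \in Q -> R \subset S :|: S' by move=> hR; apply: simp; rewrite in_setU hR orbT.
have [le1 full1] := simplex_full cZ cP simpP.
have [le2 full2] := simplex_full cZ cQ simpQ.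
have geA' : t.+2 * t.+2 <= #|P| * #|Q| by rewrite -addn2.
have [h1 h2] := product_full (ltn0Sn _) (ltn0Sn _) le1 le2 geA'.
have cZ' : #|S :|: S'| = t + 2 by rewrite cZ addn2.
have [e1 e2] := extremal_shape_A ext cZ' (full1 h1) (full2 h2).
by constructor 1; exists (S :|: S').
Qed.

End Classification.

(** * Relabelling the ground set *)

Section Transport.
Variable T : finType.
Implicit Types (s : {perm T}) (A B F S W X Y Z : {set T}).

Lemma perm_of_lists (l1 l2 : seq T) : uniq l1 -> uniq l2 -> size l1 = size l2 ->
  exists s, map s l1 = l2.
Proof.
elim: l1 l2 => [|x l1 IH] [|y l2] //=; first by exists 1%g.
move=> /andP[xl1 u1] /andP[yl2 u2] [sz]; have [s es] := IH _ u1 u2 sz.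
exists (s * tperm (s x) y)%g; rewrite permM tpermL; congr cons.
rewrite -[RHS]es; apply/eq_in_map => z zl1; rewrite permM tpermD //.
  by apply: contraNneq xl1 => /perm_inj ->.
by apply: contraNneq yl2 => ->; rewrite -es map_f.
Qed.

Lemma perm_of_sets A B A' B' : [disjoint A & B] -> [disjoint A' & B'] ->
  #|A| = #|A'| -> #|B| = #|B'| -> exists s, s @: A = A' /\ s @: B = B'.
Proof.
have uc (C D : {set T}) : [disjoint C & D] -> uniq (enum C ++ enum D).
  move=> dCD; rewrite cat_uniq !enum_uniq andbT /=; apply/hasPn => x.
  by rewrite !mem_enum => xD; rewrite (disjointFl dCD xD).
move=> d d' cA cB; have [|s] := perm_of_lists (uc _ _ d) (uc _ _ d').
  by rewrite !size_cat -!cardE cA cB.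
rewrite map_cat => /eqP; rewrite eqseq_cat ?size_map -?cardE // => /andP[/eqP eA /eqP eB].
have im (C D : {set T}) : map s (enum C) = enum D -> s @: C = D.
  move=> e; apply/setP => y; rewrite -[RHS]mem_enum -e; apply/imsetP/mapP.
    by case=> x xC ->; exists x; rewrite ?mem_enum.
  by case=> x; rewrite mem_enum => xC ->; exists x.
by exists s; split; apply: im.
Qed.

Lemma imset_permK s A : (s^-1)%g @: (s @: A) = A.
Proof.
by rewrite -imset_comp -[RHS]imset_id; apply: eq_imset => x; rewrite /= permK.
Qed.

Lemma card_perm_meet s A B : #|s @: A :&: s @: B| = #|A :&: B|.
Proof. by rewrite -imsetI ?card_imset //; [apply: perm_inj | move=> x y _ _; apply: perm_inj]. Qed.

Lemma perm_familyP s (FF GG : {set {set T}}) :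
  (forall F, F \in FF -> s @: F \in GG) -> (forall F, F \in GG -> (s^-1)%g @: F \in FF) ->
  perm_family s FF = GG.
Proof.
move=> h h'; apply/setP => F; apply/imsetP/idP => [[G hG ->]|hF]; first exact: h.
by exists ((s^-1)%g @: F); [apply: h' | rewrite -{1}(invgK s) imset_permK].
Qed.

Lemma perm_ksets s k F : (s @: F \in ksubsets [set: T] k) = (F \in ksubsets [set: T] k).
Proof. by rewrite !in_ksets card_imset //; apply: perm_inj. Qed.

Lemma perm_genStar s S k F : F \in genStar S k -> s @: F \in genStar (s @: S) k.
Proof. by rewrite inE => /andP[cF SF]; rewrite inE perm_ksets cF imsetS. Qed.

Lemma perm_genA s k t Z : perm_family s (genA k t Z) = genA k t (s @: Z).
Proof.
have go u V F : F \in genA k t V -> (u : {perm T}) @: F \in genA k t (u @: V).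
  by rewrite inE => /andP[cF h]; rewrite inE perm_ksets cF card_perm_meet.
by apply: perm_familyP => [F|F /(go (s^-1)%g)]; [exact: go | rewrite imset_permK].
Qed.

Lemma perm_genB s k a b c d : perm_family s (genB k a b c d) = genB k (s a) (s b) (s c) (s d).
Proof.
have go (u : {perm T}) x y z w F : F \in genB k x y z w ->
   u @: F \in genB k (u x) (u y) (u z) (u w).
  have im p q : [set u p; u q] = u @: [set p; q] by rewrite imsetU !imset_set1.
  by rewrite /genB !im !in_setU => /orP[/orP[]|] /(perm_genStar u) ->; rewrite ?orbT.
apply: perm_familyP => F hF; first exact: go.
by have := go (s^-1)%g _ _ _ _ _ hF; rewrite !permK.
Qed.

Lemma perm_setD1 s A i : s @: (A :\ i) = s @: A :\ s i.
Proof.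
apply/setP => y; rewrite in_setD1; apply/imsetP/andP => [[x]|[ny /imsetP[x xA e]]].
  by rewrite in_setD1 => /andP[xi xA] ->; rewrite (inj_eq perm_inj) imset_f.
by exists x; rewrite // in_setD1 xA andbT; apply: contraNneq ny => <-; rewrite e.
Qed.

Lemma perm_genC1 s l S X : perm_family s (genC1 l S X) = genC1 l (s @: S) (s @: X).
Proof.
have go (u : {perm T}) V Y F : F \in genC1 l V Y -> u @: F \in genC1 l (u @: V) (u @: Y).
  rewrite inE => /orP[/imsetP[i iV ->]|h]; rewrite inE; last by rewrite perm_genStar ?orbT.
  apply/orP; left; apply/imsetP; exists (u i); first exact: imset_f.
  by rewrite perm_setD1 imsetU.
by apply: perm_familyP => [F|F /(go (s^-1)%g)]; [exact: go | rewrite !imset_permK].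
Qed.

Lemma perm_genC2 s k t S X : perm_family s (genC2 k t S X) = genC2 k t (s @: S) (s @: X).
Proof.
have go (u : {perm T}) V Y F : F \in genC2 k t V Y -> u @: F \in genC2 k t (u @: V) (u @: Y).
  rewrite inE => /orP[|h]; rewrite in_setU; last by rewrite perm_genStar ?orbT.
  by rewrite inE => /andP[cF h]; rewrite inE perm_ksets cF !card_perm_meet h.
by apply: perm_familyP => [F|F /(go (s^-1)%g)]; [exact: go | rewrite !imset_permK].
Qed.

Lemma perm_genH s k W X Y : perm_family s (genH k W X Y) = genH k (s @: W) (s @: X) (s @: Y).
Proof.
have go (u : {perm T}) V A B F : F \in genH k V A B ->
    u @: F \in genH k (u @: V) (u @: A) (u @: B).
  rewrite in_setU => /orP[|/imsetP[i iV ->]]; rewrite in_setU.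
    rewrite inE => /and3P[cF VF h]; apply/orP; left.
    by rewrite inE perm_ksets cF card_perm_meet h imsetS.
  apply/orP; right; apply/imsetP; exists (u i); first exact: imset_f.
  by rewrite imsetU perm_setD1.
by apply: perm_familyP => [F|F /(go (s^-1)%g)]; [exact: go | rewrite !imset_permK].
Qed.

End Transport.

Section Intervals.
Variable n : nat.

Lemma card_interval a b : 0 < a -> b <= n -> #|interval n a b| = b.+1 - a.
Proof.
move=> a0; elim: b => [|b IH] bn.
  have -> : interval n a 0 = set0 by apply/setP => i; rewrite !inE ltn0 andbF.
  by rewrite cards0; lia.
have [ab|ba] := leqP a b.+1; last first.
  have -> : interval n a b.+1 = set0 by apply/setP => i; rewrite !inE; lia.
  by rewrite cards0; lia.
have -> : interval n a b.+1 = Ordinal bn |: interval n a b.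
  by apply/setP => i; rewrite !inE -val_eqE /=; lia.
by rewrite cardsU1 IH ?inE /=; lia.
Qed.

Lemma interval_disj a b c : [disjoint interval n a b & interval n b.+1 c].
Proof. by apply/pred0P => i /=; rewrite !inE; lia. Qed.

Lemma points_ord (i j : 'I_n) : points n [:: i.+1; j.+1] = [set i; j].
Proof. by apply/setP => x; rewrite !inE !eqSS. Qed.

End Intervals.

Theorem theorem1p1 (n k1 k2 t : nat) (F1 F2 : {set {set 'I_n}})
  (hn0 : 0 < n) (hk1 : 0 < k1) (hk2 : 0 < k2) (ht : 0 < t)
  (hk12 : k2 <= k1) (hk2t : t + 1 <= k2)
  (hn : (t + 1) ^ 2 * (k1 + k2) ^ 2 * (k1 - t + 1) * (k2 - t + 1) + k1 + k2 - t <= n)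
  (hF : admissible k1 k2 t F1 F2)
  (hmax : forall G1 G2 : {set {set 'I_n}}, admissible k1 k2 t G1 G2 ->
     #|G1| * #|G2| <= #|F1| * #|F2|) :
  (2 <= t ->
     isomorphic (F1, F2) (famA n k1 t, famA n k2 t)
     \/ isomorphic (F1, F2) (famC1 n k1 t, famC2 n k2 t k1)
     \/ exists X Y : {set 'I_n},
          [/\ X \in ksubsets (interval n (t + 1) n) (k1 - t + 1),
              Y \in ksubsets (interval n (t + 1) n) (k2 - t + 1),
              2 <= #|X :&: Y|
            & isomorphic (F1, F2) (famH k1 t X Y, famH k2 t Y X)])
  /\
  (t = 1 ->
     isomorphic (F1, F2) (famA n k1 1, famA n k2 1)
     \/ isomorphic (F1, F2) (famB n k1 1 3 2 4, famB n k2 1 2 3 4)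
     \/ exists X Y : {set 'I_n},
          [/\ X \in ksubsets (interval n 2 n) k1,
              Y \in ksubsets (interval n 2 n) k2,
              1 <= #|X :&: Y|
            & isomorphic (F1, F2) (famH k1 1 X Y, famH k2 1 Y X)]).
Proof.
have tk2 : t < k2 by rewrite -addn1.
have tk1 : t < k1 := leq_trans tk2 hk12.
have ext : extremal k1 k2 t F1 F2.
  by split=> //; split=> //; rewrite /large_ground card_ord.
have [_ [_ [r3 _]]] := extremal_room ext; rewrite card_ord in r3.
have {r3} room : t + 2 < n /\ k1 + 1 <= n by clear -r3 ht tk1; lia.
case: room => tn k1n.
have card_start m : m <= n -> #|interval n 1 m| = m.
  by move=> mn; rewrite card_interval // subn1.
have caseA (Z : {set 'I_n}) : #|Z| = t + 2 -> F1 = genA k1 t Z -> F2 = genA k2 t Z ->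
    isomorphic (F1, F2) (famA n k1 t, famA n k2 t).
  move=> cZ e1 e2.
  have [||||s [eZ _]] := @perm_of_sets _ Z set0 (interval n 1 (t + 2)) set0.
  - by rewrite -setI_eq0 setI0.
  - by rewrite -setI_eq0 setI0.
  - by rewrite card_start // ltnW.
  - by [].
  by exists s; rewrite /= e1 e2 !perm_genA eZ.
have caseH (W X Y : {set 'I_n}) : #|W| = t -> #|X| = k1 - t + 1 -> #|Y| = k2 - t + 1 ->
    [disjoint W & X] -> [disjoint W & Y] ->
    F1 = genH k1 W X Y -> F2 = genH k2 W Y X ->
    exists X' Y' : {set 'I_n}, [/\ X' \in ksubsets (interval n (t + 1) n) (k1 - t + 1),
      Y' \in ksubsets (interval n (t + 1) n) (k2 - t + 1), #|X' :&: Y'| = #|X :&: Y| &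
      isomorphic (F1, F2) (famH k1 t X' Y', famH k2 t Y' X')].
  move=> cW cX cY dX dY e1 e2.
  have [||||s [eW _]] := @perm_of_sets _ W set0 (interval n 1 t) set0.
  - by rewrite -setI_eq0 setI0.
  - by rewrite -setI_eq0 setI0.
  - by rewrite card_start //; clear -tn; lia.
  - by [].
  have outside (V : {set 'I_n}) k : #|V| = k -> [disjoint W & V] ->
      s @: V \in ksubsets (interval n (t + 1) n) k.
    move=> cV dV; rewrite inE card_imset; last exact: perm_inj.
    rewrite cV eqxx andbT; apply/subsetP => y /imsetP[x xV ->].
    have : s x \notin interval n 1 t.
      rewrite -eW; apply/imsetP => -[w wW /perm_inj exw].
      by rewrite -exw (disjointFl dV xV) in wW.
    by rewrite !inE; have := ltn_ord (s x); clear; lia.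
  exists (s @: X), (s @: Y); split; [exact: outside|exact: outside|exact: card_perm_meet|].
  by exists s; rewrite /= e1 e2 !perm_genH eW.
have := extremal_classification ext hk12.
case=> [[Z [cZ e1 e2]]|[t1 [S [X [cS cX dX e1 e2]]]]|[t1 [a [b [c [d [u e1 e2]]]]]]|
        [W [X [Y [cW [cX cY] [dX dY] XY [e1 e2]]]]]].
- have iso := caseA _ cZ e1 e2.
  by split=> [_|t1]; left; rewrite // -t1.
- split=> [_|e]; last by rewrite e in t1.
  right; left.
  have [||||s [eS eX]] :=
    @perm_of_sets _ S X (interval n 1 (t + 1)) (interval n (t + 1).+1 (k1 + 1)).
  + exact: dX.
  + exact: interval_disj.
  + by rewrite cS card_start //; clear -tn; lia.
  + by rewrite cX card_interval //; clear; lia.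
  exists s; rewrite /= e1 e2 perm_genC1 perm_genC2 eS eX.
  have eU : interval n 1 (t + 1) :|: interval n (t + 1).+1 (k1 + 1) = interval n 1 (k1 + 1).
    by apply/setP => i; rewrite !inE; clear -tk1; lia.
  by rewrite /genC1 eU /famC2 (addn2 t) -(addn1 t.+1) -addSn -addn1.
- split=> [t2|_]; first by rewrite t1 in t2.
  right; left.
  have n4 : 3 < n by rewrite t1 in tn.
  pose o0 := Ordinal hn0; pose o1 := Ordinal (leq_trans (isT : 1 < 4) n4).
  pose o2 := Ordinal (leq_trans (isT : 2 < 4) n4); pose o3 := Ordinal n4.
  have [||s [sa sb sc sd]] := @perm_of_lists _ [:: a; b; c; d] [:: o0; o1; o2; o3] u.
  + by rewrite -(map_inj_uniq val_inj).
  + by [].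
  exists s; rewrite /= e1 e2 !perm_genB sa sb sc sd.
  by rewrite /genB -!points_ord.
- have [X' [Y' [hX hY eXY iso]]] := caseH _ _ _ cW cX cY dX dY e1 e2.
  split=> [t2|t1]; right; right; exists X', Y'.
  + by split=> //; rewrite eXY; move: XY; rewrite (minn_idPr t2).
  by rewrite t1 !subnK // in hX hY XY iso; split=> //; rewrite eXY.
Qed.
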